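(* Let $X$ be a real Banach space and let $f:[a,b]\to X$. Then the following are equivalent. (i) There exists a homeomorphism $k$ of $[a,b]$ onto itself such that $md(f\circ k,\cdot)$ exists at every point of $[a,b]$ and is continuous on $[a,b]$. (ii) $f$ is continuous, has finite variation on $[a,b]$, and $\mathcal{H}^1(f(M_f))=0$.
   Context: For $g:[a,b]\to X$, the unilateral metric derivatives are $md_{\pm}(g,x)=\lim_{t\to0+}\frac{\|g(x\pm t)-g(x)\|}{t}$. If both exist and are equal (and finite), their common value is the metric derivative $md(g,x)$; at an endpoint of $[a,b]$ only the one-sided limit taken inside $[a,b]$ is used. $\bigvee_u^v f$ denotes the total variation of $f$ on $[u,v]$ for $u<v$, and $\bigvee_v^u f:=-\bigvee_u^v f$; $f$ has finite variation (is BV) if $\bigvee_a^b f<\infty$. $\mathcal{H}^1$ is the $1$-dimensional Hausdorff measure. A point $x\in[a,b]$ is a metrically regular point of $f$ if $\lim_{t\to0,\ x+t\in[a,b]}\frac{\|f(x+t)-f(x)\|}{\left|\bigvee_x^{x+t}f\right|}=1$ (in particular the denominator is nonzero for all small $t\ne0$). $M_f$ is the set of all points $x\in[a,b]$ for which there is no $\delta>0$ such that $U=(x-\delta,x+\delta)\subset[a,b]$ and either $f|_U$ is constant or all points of $U$ are metrically regular points of $f$. In particular $a,b\in M_f$. *)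

(* Defs.v *)
From mathcomp Require Export all_boot all_order all_algebra.
From mathcomp Require Export all_classical all_reals all_analysis.
Export Order.TTheory GRing.Theory Num.Theory.
Export numFieldNormedType.Exports.

Set Implicit Arguments.
Unset Strict Implicit.
Unset Printing Implicit Defensive.

Local Open Scope classical_set_scope.
Local Open Scope ring_scope.

(* A function [a, b] -> X is represented by a total function R -> X; every
   notion below that takes a and b depends only on its values on [a, b]. *)

(* numfun.variation and realfun.total_variation are restricted to real-valued
   functions; these are their counterparts for functions with values in a
   normed space. *)
Definition vvariation (R : realType) (X : normedModType R)
    (a b : R) (f : R -> X) (s : seq R) : R :=
  let F := f \o nth b (a :: s) in
  \sum_(0 <= n < size s) `|F n.+1 - F n|.

Definition total_vvariation (R : realType) (X : normedModType R)
    (a b : R) (f : R -> X) : \bar R :=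
  ereal_sup [set (vvariation a b f s)%:E | s in itv_partition a b].

Definition oriented_vvariation (R : realType) (X : normedModType R)
    (u v : R) (f : R -> X) : \bar R :=
  if u <= v then total_vvariation u v f else (- total_vvariation v u f)%E.

Definition is_mdr (R : realType) (X : normedModType R)
    (g : R -> X) (x m : R) : Prop :=
  `|g (x + t) - g x| / t @[t --> 0^'+] --> m.

Definition is_mdl (R : realType) (X : normedModType R)
    (g : R -> X) (x m : R) : Prop :=
  `|g (x - t) - g x| / t @[t --> 0^'+] --> m.

Definition is_md (R : realType) (X : normedModType R)
    (a b : R) (g : R -> X) (x m : R) : Prop :=
  (x < b -> is_mdr g x m) /\ (a < x -> is_mdl g x m).

Definition md_exists (R : realType) (X : normedModType R)
    (a b : R) (g : R -> X) (x : R) : Prop :=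
  exists m : R, is_md a b g x m.

Definition md (R : realType) (X : normedModType R)
    (a b : R) (g : R -> X) (x : R) : R :=
  xget 0 [set m | is_md a b g x m].

(* When the variation in the denominator is 0 or infinite, the quotient is 0
   (fine +oo = fine -oo = 0 and c / 0 = 0), so such t are incompatible with
   the limit being 1. *)
Definition metrically_regular (R : realType) (X : normedModType R)
    (a b : R) (f : R -> X) (x : R) : Prop :=
  x \in `[a, b] /\
  `|f (x + t) - f x| / `|fine (oriented_vvariation x (x + t) f)|
    @[t --> within [set t | x + t \in `[a, b]] 0^'] --> (1 : R).

Definition metrically_singular_set (R : realType) (X : normedModType R)
    (a b : R) (f : R -> X) : set R :=
  [set x | x \in `[a, b] /\
    ~ exists delta : R, let U := `]x - delta, x + delta[%classic in
        [/\ 0 < delta,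
            U `<=` `[a, b]%classic
          & (forall y z, U y -> U z -> f y = f z) \/
            (forall y, U y -> metrically_regular a b f y)]].

(* The maximum with 0 gives diam set0 = 0 instead of ereal_sup set0 = -oo. *)
Definition diam (R : realType) (X : normedModType R) (E : set X) : \bar R :=
  maxe 0%E (ereal_sup [set `|x - y|%:E | x in E & y in E]).

Definition hausdorff1_delta (R : realType) (X : normedModType R)
    (delta : R) (A : set X) : \bar R :=
  ereal_inf [set (\sum_(0 <= k <oo) diam (E k))%E | E in
    [set E : (set X)^nat | (forall k, (diam (E k) <= delta%:E)%E) /\
                           A `<=` \bigcup_k E k]].

Definition hausdorff1 (R : realType) (X : normedModType R) (A : set X)
    : \bar R :=
  ereal_sup [set hausdorff1_delta delta A | delta in [set d : R | 0 < d]].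

Definition homeomorphism (R : realType) (A B : set R) (k : R -> R) : Prop :=
  exists h : R -> R,
    [/\ set_fun A B k, set_fun B A h, {in A, cancel k h} & {in B, cancel h k}]
    /\ {within A, continuous k} /\ {within B, continuous h}.

(* Main.v *)
Require Import Defs.
From mathcomp Require Import measurable_realfun.
From mathcomp Require Import lra.

Set Implicit Arguments.
Unset Strict Implicit.
Unset Printing Implicit Defensive.

Local Open Scope classical_set_scope.
Local Open Scope ring_scope.

(** (i) => (ii).  If g = f o k has a continuous metric derivative m, then g is
    C-Lipschitz wherever m <= C, so f is continuous and BV.  Where m > 0 the
    variation of g on a short interval is at most (sup m) times its length, and
    the increment of g is comparable to m times the length, so the ratio tends
    to 1 and the point is metrically regular.  Hence M_f consists of a, b and
    points where m = 0, and the latter are mapped to an H^1-null set because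
    short intervals meeting {m = 0} have images of diameter at most
    epsilon times their length.

    (ii) => (i).  Let v be the variation function of f and M = M_f.  A connected
    set has H^1-measure at least its diameter, so covering f([p, q]) by a cover
    of f(M) of small total diameter and the images of intervals covering
    [v p, v q] \ v(M) gives |f q - f p| <= (v q - v p) - |v(M) /\ [v p, v q]|;
    summing over fine partitions, v(M) is Lebesgue-null.  Then there is a
    continuous rho >= 0 vanishing on v(M) with 1 / rho integrable.  Let w be a
    primitive of 1 / rho, and add to w o v the function growing at unit rate
    exactly on the intervals of constancy of f.  After normalization, this is a
    homeomorphism whose inverse k satisfies md (f o k) = const * rho o v o k. *)

(** * Epsilon-delta forms and induction on a segment *)

Section epsilon_delta.
Context {R : realType} {X : normedModType R}.
Implicit Types (a b x m : R) (g : R -> X).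

Lemma nbhs_deltaP (x : R) (P : R -> Prop) :
  nbhs x P <-> exists2 d : R, 0 < d & forall y, `|y - x| < d -> P y.
Proof.
rewrite -(@filter_from_ballE R R); split => -[d /= d0 H]; exists d => // y /=.
  by move=> yx; apply: H => /=; rewrite /ball/= distrC.
by rewrite /ball/= distrC => /H.
Qed.

Lemma within_continuousP a b g : {within `[a, b], continuous g} <->
  forall x, x \in `[a, b] -> forall e : R, 0 < e -> exists2 d : R, 0 < d &
    forall y, y \in `[a, b] -> `|y - x| < d -> `|g y - g x| <= e.
Proof.
split=> [/subspace_continuousP cg x xab e e0|cg].
  have /cvgrPdist_le /(_ e e0) := cg x xab.
  move=> /nbhs_deltaP[d d0 H]; exists d => // y yab yx.
  by rewrite distrC; apply: H.
apply/subspace_continuousP => x xab; apply/cvgrPdist_le => e e0.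
have [d d0 H] := cg x xab e e0.
by apply/nbhs_deltaP; exists d => // y yx yab; rewrite distrC; exact: H.
Qed.

(** Clearing the denominator merges the two one-sided limits into one estimate over [a, b]. It is
    trivial at y = x, and at an endpoint the side without a limit contains no point of [a, b]. *)
Lemma is_mdP a b g x m : x \in `[a, b] -> is_md a b g x m <->
  forall e : R, 0 < e -> exists2 d : R, 0 < d & forall y, y \in `[a, b] ->
    `|y - x| < d -> `| `|g y - g x| - m * `|y - x| | <= e * `|y - x|.
Proof.
move=> xab; split=> [[mr ml] e e0|H].
  have [dr dr0 Hr] : exists2 d : R, 0 < d & forall y, x < y -> y \in `[a, b] ->
      `|y - x| < d -> `| `|g y - g x| - m * `|y - x| | <= e * `|y - x|.
    have [xb|bx] := ltP x b; last first.
      by exists 1 => // y; rewrite in_itv/= => xy /andP[ay yb]; lra.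
    have /cvgrPdist_le /(_ e e0) /nbhs_deltaP[d d0 H] := mr xb.
    exists d => // y xy yab yx.
    have := H (y - x); rewrite subr0 subr_gt0 => /(_ yx xy).
    rewrite [x + _]addrC subrK distrC (gtr0_norm (_ : 0 < y - x)) ?subr_gt0//.
    rewrite -(ler_pM2r (_ : 0 < y - x)) ?subr_gt0//.
    rewrite -{2}(gtr0_norm (_ : 0 < y - x)) ?subr_gt0// -normrM.
    by rewrite mulrBl mulfVK// subr_eq0 gt_eqF.
  have [dl dl0 Hl] : exists2 d : R, 0 < d & forall y, y < x -> y \in `[a, b] ->
      `|y - x| < d -> `| `|g y - g x| - m * `|y - x| | <= e * `|y - x|.
    have [ax|xa] := ltP a x; last first.
      by exists 1 => // y; rewrite in_itv/= => xy /andP[ay yb]; lra.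
    have /cvgrPdist_le /(_ e e0) /nbhs_deltaP[d d0 H] := ml ax.
    exists d => // y xy yab yx.
    have := H (x - y); rewrite subr0 subr_gt0 distrC => /(_ yx xy).
    rewrite opprB [x + _]addrC subrK distrC [`|y - x|]distrC.
    rewrite (gtr0_norm (_ : 0 < x - y)) ?subr_gt0//.
    rewrite -(ler_pM2r (_ : 0 < x - y)) ?subr_gt0//.
    rewrite -{2}(gtr0_norm (_ : 0 < x - y)) ?subr_gt0// -normrM.
    by rewrite mulrBl mulfVK// subr_eq0 gt_eqF.
  exists (Num.min dr dl); first by rewrite lt_min dr0.
  move=> y yab; rewrite lt_min => /andP[yr yl].
  have [xy|yx|<-] := ltgtP x y; [exact: Hr|exact: Hl|].
  by rewrite !subrr !normr0 !mulr0 subrr normr0.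
split=> hx; apply/cvgrPdist_le => e e0; have [d d0 Hd] := H _ e0.
  apply/nbhs_deltaP; exists (Num.min d (b - x)).
    by rewrite lt_min d0 subr_gt0.
  move=> t; rewrite subr0 lt_min => /andP[td tb] t0.
  move: xab td tb; rewrite in_itv/= (gtr0_norm t0) => /andP[ax xb] td tb.
  rewrite distrC -(ler_pM2r t0) -[X in _ * X <= _](gtr0_norm t0) -normrM mulrBl
  mulfVK ?gt_eqF//.
  have := Hd (x + t); rewrite in_itv/= addrAC subrr add0r (gtr0_norm t0).
  by move=> /(_ _ td); apply; apply/andP; split; lra.
apply/nbhs_deltaP; exists (Num.min d (x - a)).
  by rewrite lt_min d0 subr_gt0.
move=> t; rewrite subr0 lt_min => /andP[td tb] t0.
move: xab td tb; rewrite in_itv/= (gtr0_norm t0) => /andP[ax xb] td tb.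
rewrite distrC -(ler_pM2r t0) -[X in _ * X <= _](gtr0_norm t0) -normrM mulrBl
  mulfVK ?gt_eqF//.
have := Hd (x - t); rewrite in_itv/= addrAC subrr add0r normrN (gtr0_norm t0).
by move=> /(_ _ td); apply; apply/andP; split; lra.
Qed.

(** As a < b, at least one of the two one-sided limits is a genuine condition at x, so uniqueness of
    limits determines the value picked by [xget]. *)
Lemma mdE a b g x m : a < b -> x \in `[a, b] -> is_md a b g x m ->
  md a b g x = m.
Proof.
move=> ab xab Hm.
have : is_md a b g x (md a b g x) by rewrite /md; case: xgetP => // /(_ m).
move: xab; rewrite in_itv/= => /andP[ax xb].
have [ax'|xa] := ltP a x.
  by case=> _ /(_ ax') H; apply: (cvg_unique _ H) => //; apply: (Hm.2 ax').
have xb' : x < b by lra.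
by case=> /(_ xb') H _; apply: (cvg_unique _ H) => //; apply: (Hm.1 xb').
Qed.

End epsilon_delta.

(** * Points lying between two points of a segment *)

Section segments.
Context {R : realType}.
Implicit Types a b d p q u x z : R.

Lemma segment_convex a b p q x : p \in `[a, b] -> q \in `[a, b] ->
  p <= x <= q -> x \in `[a, b].
Proof.
rewrite !in_itv/= => /andP[ap _] /andP[_ qb] /andP[px xq].
by rewrite (le_trans ap px) (le_trans xq qb).
Qed.

Lemma segment_minmax a b p q x : p \in `[a, b] -> q \in `[a, b] ->
  Num.min p q <= x <= Num.max p q -> x \in `[a, b].
Proof. by case: (leP p q) => _ pab qab; exact: segment_convex. Qed.

Lemma dist_convex z d p q x : `|p - z| < d -> `|q - z| < d ->
  p <= x <= q -> `|x - z| < d.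
Proof.
rewrite !ltr_norml => /andP[pz _] /andP[_ qz] /andP[px xq].
by apply/andP; split; lra.
Qed.

Lemma dist_minmax z d p q x : `|p - z| < d -> `|q - z| < d ->
  Num.min p q <= x <= Num.max p q -> `|x - z| < d.
Proof. by case: (leP p q) => _ ? ?; exact: dist_convex. Qed.

Lemma dist_segment_lt p q d x u : p <= x -> x <= q -> q - p < d ->
  u \in `[p, q] -> `|u - x| < d.
Proof.
move=> px xq qd; rewrite in_itv/= ltr_norml => /andP[pu uq].
by apply/andP; split; lra.
Qed.

Lemma dist_segment_le p q x u : x \in `[p, q] -> u \in `[p, q] ->
  `|u - x| <= q - p.
Proof.
rewrite !in_itv/= ler_norml => /andP[px xq] /andP[pu uq].
by apply/andP; split; lra.
Qed.

End segments.

(* Cousin's lemma, by the supremum of the points reachable from a. *)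
Lemma segment_induction {R : realType} (a b : R) (P : R -> R -> Prop) :
  a <= b ->
  (forall x y z, a <= x -> x <= y -> y <= z -> z <= b ->
     P x y -> P y z -> P x z) ->
  (forall x, x \in `[a, b] -> exists2 d : R, 0 < d &
     forall y z, y \in `[a, b] -> z \in `[a, b] -> y <= x -> x <= z ->
       z - y < d -> P y z) ->
  P a b.
Proof.
move=> ab Padd Ploc.
pose S := [set x | x \in `[a, b] /\ P a x].
have Sa : S a.
  split; first by rewrite in_itv/= lexx.
  have [|d d0 H] := Ploc a; first by rewrite in_itv/= lexx.
  by apply: H; rewrite ?in_itv/= ?lexx// subrr.
have Sub : ubound S b by move=> x [+ _]; rewrite in_itv/= => /andP[].
have hS : has_sup S by split; [exists a|exists b].
have Sc : sup S \in `[a, b].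
  rewrite in_itv/=; apply/andP; split.
    by apply: ub_le_sup => //; exists b.
  by apply: ge_sup => //; exists a.
have [d d0 H] := Ploc _ Sc; move: (Sc); rewrite in_itv/= => /andP[ac cb].
have [x [xab Pax] xc] := sup_adherent d0 hS.
have xs : x <= sup S by apply: ub_le_sup; [exists b|].
move: (xab); rewrite in_itv/= => /andP[ax xb].
have step z : sup S <= z -> z <= b -> z - x < d -> P a z.
  move=> sz zb zx; apply: (Padd _ x) => //; first lra.
  by apply: H => //; rewrite in_itv/=; apply/andP; split; lra.
have [sb|bs] := ltP (sup S) b; last first.
  have -> : b = sup S by apply/le_anti/andP.
  by apply: step => //; lra.
(* As sup S < x + d, this z lies strictly beyond sup S and still within d of the reachable point x.
   It is then reachable, contradicting the supremum. *)
pose z := Num.min b ((sup S + (x + d)) / 2).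
have z1 : sup S < z by rewrite lt_min sb/=; lra.
have zb : z <= b by rewrite ge_min lexx.
have zx : z <= (sup S + (x + d)) / 2 by rewrite ge_min lexx orbT.
have : S z.
  by split; [rewrite in_itv/=; apply/andP; split; lra|apply: step; lra].
by move/(ub_le_sup (ex_intro _ b Sub)); rewrite leNgt z1.
Qed.

(** * Variation of vector-valued functions *)

Section variation.
Context {R : realType} {X : normedModType R}.
Implicit Types (f : R -> X) (x y z p : R) (s : seq R).

Lemma vvariation_nil x y f : vvariation x y f [::] = 0.
Proof. by rewrite /vvariation big_nil. Qed.

Lemma vvariation_cons x y f p s :
  vvariation x y f (p :: s) = `|f p - f x| + vvariation p y f s.
Proof. by rewrite /vvariation big_nat_recl. Qed.

Lemma itv_partition_consP x y p s :
  itv_partition x y (p :: s) <-> x < p /\ itv_partition p y s.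
Proof.
rewrite /itv_partition/=; split; first by case=> /andP[-> ->] ->.
by case=> -> [-> ->].
Qed.

Lemma itv_partition_nilP x y : itv_partition x y [::] <-> x = y.
Proof. by split=> [[_ /eqP]//|->]; split=> /=. Qed.

Lemma itv_partition_le x y s : itv_partition x y s -> x <= y.
Proof.
elim: s x => [x /itv_partition_nilP -> //|p s ih x].
by move=> /itv_partition_consP[xp /ih]; apply: le_trans; exact: ltW.
Qed.

Lemma vvariation_le x y f s : itv_partition x y s ->
  ((vvariation x y f s)%:E <= total_vvariation x y f)%E.
Proof. by move=> ?; apply: ereal_sup_ubound; exists s. Qed.

Lemma total_vvariation_le x y f (c : \bar R) :
  (forall s, itv_partition x y s -> ((vvariation x y f s)%:E <= c)%E) ->
  (total_vvariation x y f <= c)%E.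
Proof. by move=> H; apply: ge_ereal_sup => _ [s /H ? <-]. Qed.

Lemma total_vvariationxx x f : total_vvariation x x f = 0%E.
Proof.
apply/eqP; rewrite eq_le; apply/andP; split.
  apply: total_vvariation_le => -[_|p s]; first by rewrite vvariation_nil.
  by move=> /itv_partition_consP[xp /itv_partition_le]; rewrite leNgt xp.
have /(@vvariation_le _ _ f) : itv_partition x x [::].
  exact/itv_partition_nilP.
by rewrite vvariation_nil.
Qed.

Lemma dist_le_total_vvariation x y f : x <= y ->
  (`|f y - f x|%:E <= total_vvariation x y f)%E.
Proof.
rewrite le_eqVlt => /predU1P[->|xy].
  by rewrite total_vvariationxx subrr normr0.
have := @vvariation_le _ _ f _ (itv_partition1 xy).
by rewrite vvariation_cons vvariation_nil addr0.
Qed.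

Lemma total_vvariation_ge0 x y f : x <= y -> (0 <= total_vvariation x y f)%E.
Proof.
move=> /(dist_le_total_vvariation f); apply: le_trans.
by rewrite lee_fin.
Qed.

(** Prefixing p to a partition of [p, y] gives a partition of [x, y]. Partitions are strictly
    increasing, so x = p is treated apart. *)
Lemma dist_add_total_vvariation x p y f : x <= p ->
  (`|f p - f x|%:E + total_vvariation p y f <= total_vvariation x y f)%E.
Proof.
rewrite le_eqVlt => /predU1P[->|xp].
  by rewrite subrr normr0 add0e.
rewrite -leeBrDl//; apply: total_vvariation_le => s ps; rewrite leeBrDl//.
rewrite -EFinD -vvariation_cons; apply: vvariation_le.
exact/itv_partition_consP.
Qed.

Lemma total_vvariationD x y z f : x <= y -> y <= z ->
  total_vvariation x z f = (total_vvariation x y f + total_vvariation y z f)%E.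
Proof.
move=> xy yz; apply/eqP; rewrite eq_le; apply/andP; split.
  apply: total_vvariation_le => s; elim: s x xy => [|p s ih] x xy.
    move=> _; rewrite vvariation_nil.
    by apply: adde_ge0; exact: total_vvariation_ge0.
  move=> /itv_partition_consP[xp ps].
  rewrite vvariation_cons EFinD; have [py|yp] := leP p y.
    apply: le_trans (leeD2r _ (dist_add_total_vvariation y f (ltW xp))).
    by rewrite -addeA leeD2l// ih.
  (* Here y < p, so the first interval [x, p] straddles y or starts there, and the triangle
     inequality inserts y into the partition. *)
  apply: (@le_trans _ _
    (`|f y - f x|%:E + (`|f p - f y|%:E + (vvariation p z f s)%:E)))%E.
    rewrite -!EFinD lee_fin addrA lerD2r addrC.
    by rewrite -[X in `|X|](subrKA (f y)) ler_normD.
  apply: leeD; first exact: dist_le_total_vvariation.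
  rewrite -EFinD -vvariation_cons; apply: vvariation_le.
  exact/itv_partition_consP.
(* For the converse inequality, finite variation on [x, z] makes the variation on [y, z] finite, so
   that it can be moved across the inequality. *)
have [t|] := eqVneq (total_vvariation x z f) +oo%E; first by rewrite t leey.
rewrite -ltey => Vfin.
have Vyz : total_vvariation y z f \is a fin_num.
  rewrite ge0_fin_numE ?total_vvariation_ge0//; apply: le_lt_trans Vfin.
  apply: le_trans (dist_add_total_vvariation z f xy).
  by rewrite leeDr// lee_fin.
rewrite -leeBrDr//; apply: total_vvariation_le => s; rewrite leeBrDr//.
clear Vfin; elim: s x xy => [|p s ih] x xy.
  by move=> /itv_partition_nilP ->; rewrite vvariation_nil add0e.
move=> /itv_partition_consP[xp ps]; rewrite vvariation_cons EFinD -addeA.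
apply: le_trans (dist_add_total_vvariation z f (ltW xp)).
by rewrite leeD2l// ih// (itv_partition_le ps).
Qed.

Lemma total_vvariation_const x y f : x <= y ->
  (forall z, z \in `[x, y] -> f z = f x) -> total_vvariation x y f = 0%E.
Proof.
move=> xy fc; apply/eqP; rewrite eq_le total_vvariation_ge0// andbT.
apply: total_vvariation_le => s; elim: s x xy fc => [|p s ih] x xy fc.
  by rewrite vvariation_nil.
move=> /itv_partition_consP[xp ps]; have py := itv_partition_le ps.
rewrite vvariation_cons (fc p) ?in_itv/= ?(ltW xp)// subrr normr0 add0r.
apply: ih => // z; rewrite in_itv/= => /andP[pz zy].
rewrite !fc// in_itv/= ?(ltW xp)//; apply/andP; split => //; lra.
Qed.

(** The point p is the last but one of the partition. Partitions are built from the left, and this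
    gives access to their right end. *)
Lemma total_vvariation_le_last x y f s : x < y -> itv_partition x y s ->
  exists p, [/\ x <= p, p < y & ((vvariation x y f s)%:E <=
    total_vvariation x p f + `|f y - f p|%:E)%E].
Proof.
elim: s x => [|p s ih] x xy; first by move=> /itv_partition_nilP; lra.
move=> /itv_partition_consP[xp ps]; have := itv_partition_le ps.
rewrite le_eqVlt => /predU1P[py|py].
  exists x; rewrite total_vvariationxx add0e lexx; split => //.
  case: s ps {ih} => [_|q s /itv_partition_consP[pq /itv_partition_le]].
    by rewrite vvariation_cons vvariation_nil addr0 py.
  by rewrite leNgt -py pq.
have [q [pq qy H]] := ih _ py ps.
exists q; split => //; first lra.
rewrite vvariation_cons EFinD.
apply: le_trans (leeD2r _ (dist_add_total_vvariation q f (ltW xp))).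
by rewrite -addeA leeD2l.
Qed.

End variation.

(** * The variation function of a curve of finite variation *)

Section bounded_variation.
Context {R : realType} {X : normedModType R}.
Variables (a b : R) (f : R -> X).
Hypothesis ab : a < b.
Hypothesis bvf : (total_vvariation a b f < +oo)%E.

(** The arc length from a. Under [bvf] the variation is finite on [a, b], so [fine] loses nothing
    there. *)
Definition arc x := fine (total_vvariation a x f).
Local Notation v := arc.

Lemma total_vvariation_fin x y : a <= x -> x <= y -> y <= b ->
  total_vvariation x y f \is a fin_num.
Proof.
move=> ax xy yb; rewrite ge0_fin_numE ?total_vvariation_ge0//.
apply: le_lt_trans bvf; rewrite (@total_vvariationD _ _ a x b)//; last lra.
rewrite (@total_vvariationD _ _ x y b)//.
apply: (@le_trans _ _ (total_vvariation x y f + total_vvariation y b f))%E.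
  by rewrite leeDl// total_vvariation_ge0.
by rewrite leeDr// total_vvariation_ge0.
Qed.

Lemma total_vvariationE x y : a <= x -> x <= y -> y <= b ->
  total_vvariation x y f = (v y - v x)%:E.
Proof.
move=> ax xy yb; have ay := le_trans ax xy; have xb := le_trans xy yb.
rewrite EFinB /v !fineK ?total_vvariation_fin//.
rewrite (@total_vvariationD _ _ a x y)// addeAC subee ?add0e//.
exact: total_vvariation_fin.
Qed.

Lemma arca : v a = 0.
Proof. by rewrite /v total_vvariationxx. Qed.

Lemma arc_le x y : a <= x -> x <= y -> y <= b -> v x <= v y.
Proof.
move=> ax xy yb; rewrite -subr_ge0 -lee_fin -total_vvariationE//.
exact: total_vvariation_ge0.
Qed.

Lemma dist_le_arcB x y : a <= x -> x <= y -> y <= b ->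
  `|f y - f x| <= v y - v x.
Proof.
move=> ax xy yb; rewrite -lee_fin -total_vvariationE//.
exact: dist_le_total_vvariation.
Qed.

Lemma dist_le_arc x y : x \in `[a, b] -> y \in `[a, b] ->
  `|f y - f x| <= `|v y - v x|.
Proof.
rewrite !in_itv/= => /andP[ax xb] /andP[ay yb].
have [xy|/ltW yx] := leP x y.
  by rewrite (le_trans (dist_le_arcB ax xy yb))// ler_norm.
rewrite distrC [X in _ <= X]distrC.
by rewrite (le_trans (dist_le_arcB ay yx xb))// ler_norm.
Qed.

Lemma oriented_vvariationE x y : x \in `[a, b] -> y \in `[a, b] ->
  `|fine (oriented_vvariation x y f)| = `|v y - v x|.
Proof.
rewrite !in_itv/= => /andP[ax xb] /andP[ay yb]; rewrite /oriented_vvariation.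
case: leP => [xy|/ltW yx]; first by rewrite total_vvariationE.
by rewrite total_vvariationE//= normrN distrC.
Qed.

Lemma arc_const x y : a <= x -> x <= y -> y <= b ->
  (forall z, z \in `[x, y] -> f z = f x) -> v x = v y.
Proof.
move=> ax xy yb /(total_vvariation_const xy).
by rewrite total_vvariationE// => -[] /eqP; rewrite subr_eq0 => /eqP.
Qed.

Lemma arc_approx x y e : a <= x -> x <= y -> y <= b -> 0 < e ->
  exists2 s, itv_partition x y s & v y - v x - e <= vvariation x y f s.
Proof.
move=> ax xy yb e0; have Vfin := total_vvariation_fin ax xy yb.
have [_ [s ps <-] H] := ub_ereal_sup_adherent e0 Vfin.
exists s => //; apply/ltW; rewrite -lte_fin EFinB -total_vvariationE//.
Qed.

(** If a partition of [x, b] misses the variation by at most e, then so does each of its intervals;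
    p ends the first one. *)
Lemma arc_right_approx x e : a <= x -> x < b -> 0 < e ->
  exists p, [/\ x < p, p <= b & v p - v x <= `|f p - f x| + e].
Proof.
move=> ax xb e0; have [s] := arc_approx ax (ltW xb) (lexx b) e0.
case: s => [/itv_partition_nilP|p s]; first lra.
move=> /itv_partition_consP[xp ps] H; exists p.
have pb := itv_partition_le ps; split => //.
have : vvariation p b f s <= v b - v p.
  rewrite -lee_fin -total_vvariationE// ?vvariation_le//; lra.
rewrite vvariation_cons in H; lra.
Qed.

Lemma arc_left_approx x e : a < x -> x <= b -> 0 < e ->
  exists p, [/\ a <= p, p < x & v x - v p <= `|f x - f p| + e].
Proof.
move=> ax xb e0; have [s ps H] := arc_approx (lexx a) (ltW ax) xb e0.
have [p [ap px Hp]] := total_vvariation_le_last f ax ps; exists p; split => //.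
rewrite total_vvariationE// -?EFinD ?lee_fin in Hp; lra.
Qed.

(** For y between x and the point p of [arc_right_approx], v y - v x = (v p - v x) - (v p - v y) is
    at most |f p - f x| + e/2 - |f p - f y|, hence at most |f y - f x| + e/2. The left side is
    symmetric. *)
Lemma arc_continuous : {within `[a, b], continuous f} ->
  {within `[a, b], continuous v}.
Proof.
move=> /within_continuousP cf; apply/within_continuousP => x xab e e0.
move: (xab); rewrite in_itv/= => /andP[ax xb].
have e20 : 0 < e / 2 by lra.
have [d d0 Hd] := cf x xab _ e20.
have [dr dr0 Hr] : exists2 d : R, 0 < d & forall y, y \in `[a, b] -> x <= y ->
    `|y - x| < d -> `|v y - v x| <= e.
  have [xb'|bx] := ltP x b; last first.
    exists 1 => // y; rewrite in_itv/= => /andP[ay yb] xy _.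
    by have -> : y = x; [lra|rewrite subrr normr0 ltW].
  have [p [xp pb Hp]] := arc_right_approx ax xb' e20.
  exists (Num.min d (p - x)); first by rewrite lt_min d0 subr_gt0.
  move=> y yab xy; rewrite lt_min => /andP[yd yp].
  have := Hd y yab yd; move: (yab); rewrite in_itv/= => /andP[ay yb] Hy.
  rewrite ger0_norm ?subr_ge0 in yp; last lra.
  have yp' : y <= p by lra.
  rewrite ger0_norm ?subr_ge0 ?arc_le//.
  have := dist_le_arcB ay yp' pb.
  have : `|f p - f x| <= `|f p - f y| + `|f y - f x|.
    by rewrite -[X in `|X|](subrKA (f y)) ler_normD.
  lra.
have [dl dl0 Hl] : exists2 d : R, 0 < d & forall y, y \in `[a, b] -> y <= x ->
    `|y - x| < d -> `|v y - v x| <= e.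
  have [ax'|xa] := ltP a x; last first.
    exists 1 => // y; rewrite in_itv/= => /andP[ay yb] xy _.
    by have -> : y = x; [lra|rewrite subrr normr0 ltW].
  have [p [ap px Hp]] := arc_left_approx ax' xb e20.
  exists (Num.min d (x - p)); first by rewrite lt_min d0 subr_gt0.
  move=> y yab yx; rewrite lt_min => /andP[yd yp].
  have := Hd y yab yd; move: (yab); rewrite in_itv/= => /andP[ay yb] Hy.
  rewrite distrC ger0_norm ?subr_ge0 in yp; last lra.
  have py : p <= y by lra.
  rewrite distrC ger0_norm ?subr_ge0 ?arc_le//.
  have := dist_le_arcB ap py yb.
  have : `|f x - f p| <= `|f y - f p| + `|f y - f x|.
    rewrite [X in _ <= _ + X]distrC [X in _ <= X]addrC.
    by rewrite -[X in `|X|](subrKA (f y)) ler_normD.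
  lra.
exists (Num.min dr dl); first by rewrite lt_min dr0.
move=> y yab; rewrite lt_min => /andP[yr yl].
by have [xy|/ltW yx] := leP x y; [exact: Hr|exact: Hl].
Qed.

Lemma metrically_regularP x : metrically_regular a b f x ->
  forall e : R, 0 < e -> exists2 d : R, 0 < d & forall y, y \in `[a, b] ->
    y != x -> `|y - x| < d -> v y != v x /\
      `| `|f y - f x| - `|v y - v x| | <= e * `|v y - v x|.
Proof.
move=> [xab /cvgrPdist_lt H] e e0.
(* A quotient with zero denominator is 0, at distance 1 from the limit; a tolerance of at most 1
   with strict inequality therefore forces v y != v x. *)
have : 0 < Num.min e 1 by rewrite lt_min e0/=.
move=> /H /nbhs_deltaP[d d0 Hd]; exists d => // y yab yx yd.
have /(_ _ _) := Hd (y - x); rewrite subr0 => /(_ yd).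
rewrite subr_eq0/= [x + (_ - _)]addrC subrK => /(_ yx yab).
rewrite oriented_vvariationE// lt_min => /andP[He H1].
have vyx : v y != v x.
  apply: contraTN H1 => /eqP ->.
  by rewrite subrr normr0 invr0 mulr0 subr0 normr1 ltxx.
split=> //.
have v0 : 0 < `|v y - v x| by rewrite normr_gt0 subr_eq0.
move: He; rewrite -(ltr_pM2r v0) -[X in _ * X < _](ger0_norm (ltW v0)) -normrM.
by rewrite mulrBl mulfVK ?gt_eqF// mul1r distrC => /ltW.
Qed.

End bounded_variation.

(** * Curves with a continuous metric derivative *)

Section diameter.
Context {R : realType} {X : normedModType R}.
Implicit Types (A E : set X).

Lemma diam_ge0 E : (0 <= diam E)%E.
Proof. by rewrite /diam le_max lexx. Qed.

Lemma dist_le_diam E (u w : X) : E u -> E w -> (`|u - w|%:E <= diam E)%E.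
Proof.
move=> Eu Ew; rewrite /diam le_max; apply/orP; right.
by apply: ereal_sup_ubound; exists u => //; exists w.
Qed.

Lemma diam_le E (c : \bar R) : (0 <= c)%E ->
  (forall u w, E u -> E w -> (`|u - w|%:E <= c)%E) -> (diam E <= c)%E.
Proof.
move=> c0 H; rewrite /diam ge_max c0/=.
by apply: ge_ereal_sup => _ [u Eu [w Ew <-]]; exact: H.
Qed.

Lemma diam0 : diam (@set0 X) = 0%E.
Proof. by apply/eqP; rewrite eq_le diam_ge0 diam_le. Qed.

Lemma diam1 (u : X) : diam [set u] = 0%E.
Proof.
apply/eqP; rewrite eq_le diam_ge0 diam_le//.
by move=> _ _ -> ->; rewrite subrr normr0.
Qed.

(** A finite cover is turned into a sequence by padding it with empty sets, which have diameter
    0. *)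
Lemma nneseries_diam_seq (s : seq (set X)) :
  (\sum_(0 <= k <oo) diam (nth set0 s k))%E = (\sum_(E <- s) diam E)%E.
Proof.
rewrite (nneseries_split 0 (size s)); last by move=> *; exact: diam_ge0.
rewrite add0n eseries0 ?adde0; first by rewrite (big_nth set0).
by move=> i si _; rewrite nth_default ?diam0.
Qed.

Lemma hausdorff1_delta_ge0 d A : (0 <= hausdorff1_delta d A)%E.
Proof.
apply: le_ereal_inf_tmp => _ [E _ <-].
by apply: nneseries_ge0 => *; exact: diam_ge0.
Qed.

Lemma hausdorff1_eq0P A : hausdorff1 A = 0%E <->
  forall d e : R, 0 < d -> 0 < e -> exists E : (set X)^nat,
    [/\ forall k, (diam (E k) <= d%:E)%E, A `<=` \bigcup_k E k &
        (\sum_(0 <= k <oo) diam (E k) <= e%:E)%E].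
Proof.
split=> [A0 d e d0 e0|H].
  have H0 : hausdorff1_delta d A = 0%E.
    apply/eqP; rewrite eq_le hausdorff1_delta_ge0 andbT -A0.
    by apply: ereal_sup_ubound; exists d.
  have : hausdorff1_delta d A \is a fin_num by rewrite H0.
  move=> /(lb_ereal_inf_adherent e0)[_ [E [Ed AE] <-]].
  rewrite -/(hausdorff1_delta d A) H0 add0e => /ltW ?.
  by exists E.
apply/eqP; rewrite eq_le; apply/andP; split.
  apply: ge_ereal_sup => _ [d d0 <-]; apply/lee_addgt0Pr => e e0; rewrite add0e.
  have [E [Ed AE sE]] := H _ _ d0 e0.
  apply: ge_ereal_inf; exists (\sum_(0 <= k <oo) diam (E k))%E => //.
  by exists E.
apply: le_trans (hausdorff1_delta_ge0 1 A) _.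
by apply: ereal_sup_ubound; exists 1 => //=.
Qed.

End diameter.

(** Used for x = mu and y = eta, to bound (mu - eta) / (mu + eta) from below by 1 - e. *)
Lemma onem_ratio_le {R : realType} (e x y : R) : 0 < e -> 0 < y ->
  y <= x * e / 2 -> (1 - e) * (x + y) <= x - y.
Proof. by move=> e0 y0 yx; nra. Qed.

(** * Lipschitz bounds, zeros of the metric derivative, and regular points *)

Section continuous_metric_derivative.
Context {R : realType} {X : normedModType R}.
Variables (a b : R) (g : R -> X) (m : R -> R).
Hypothesis ab : a < b.
Hypothesis gm : forall x, x \in `[a, b] -> is_md a b g x (m x).

(** A mean value inequality by [segment_induction]: the bound with slope C + e' is additive over
    adjacent intervals, and it holds on small intervals around x by comparing both ends with x. *)
Lemma md_lipschitz C p q : a <= p -> p <= q -> q <= b ->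
  (forall x, x \in `[p, q] -> m x <= C) -> `|g q - g p| <= C * (q - p).
Proof.
move=> ap pq qb mC; apply/ler_addgt0Pr => e e0.
(* The summand 1 keeps the denominator positive when p = q. *)
pose e' := e / (q - p + 1).
have e'0 : 0 < e' by rewrite divr_gt0//; lra.
have e'e : e' * (q - p) <= e.
  have : e' * (q - p + 1) = e by rewrite /e' mulfVK// gt_eqF//; lra.
  nra.
suff : `|g q - g p| <= (C + e') * (q - p) by nra.
apply: (@segment_induction _ p q
  (fun y z => `|g z - g y| <= (C + e') * (z - y))) => //.
  move=> x y z px xy yz zq H1 H2.
  have : `|g z - g x| <= `|g z - g y| + `|g y - g x|.
    by rewrite -[X in `|X|](subrKA (g y)) ler_normD.
  nra.
move=> x xpq; move: (xpq); rewrite in_itv/= => /andP[px xq].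
have xab : x \in `[a, b] by rewrite in_itv/=; apply/andP; split; lra.
have /(is_mdP _ _ xab)/(_ _ e'0)[d d0 Hd] := gm xab; exists d => // y z.
rewrite !in_itv/= => /andP[py yq] /andP[pz zq] yx xz zy.
have mx := mC x xpq.
have Hz : `|g z - g x| <= (C + e') * (z - x).
  have := Hd z; rewrite in_itv/= (ger0_norm (_ : 0 <= z - x)); last by lra.
  move=> /(_ _ _)/wrap[]; [by apply/andP; split; lra|by lra|].
  by rewrite ler_norml => /andP[_]; nra.
have Hy : `|g x - g y| <= (C + e') * (x - y).
  have := Hd y; rewrite in_itv/= distrC (distrC (g y)).
  rewrite (ger0_norm (_ : 0 <= x - y)); last by lra.
  move=> /(_ _ _)/wrap[]; [by apply/andP; split; lra|by lra|].
  by rewrite ler_norml => /andP[_]; nra.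
have : `|g z - g y| <= `|g z - g x| + `|g x - g y|.
  by rewrite -[X in `|X|](subrKA (g x)) ler_normD.
nra.
Qed.

Lemma md_dist_le C p q : p \in `[a, b] -> q \in `[a, b] ->
  (forall x, Num.min p q <= x <= Num.max p q -> m x <= C) ->
  `|g q - g p| <= C * `|q - p|.
Proof.
rewrite !in_itv/= => /andP[ap pb] /andP[aq qb]; case: (leP p q) => pq H.
  rewrite (ger0_norm (_ : 0 <= q - p)); last by lra.
  by apply: md_lipschitz => // x; rewrite in_itv/=; exact: H.
rewrite distrC (distrC q) (ger0_norm (_ : 0 <= p - q)); last by lra.
by apply: md_lipschitz (ltW pq) _ _ => // x; rewrite in_itv/=; exact: H.
Qed.

Lemma md_continuous : {within `[a, b], continuous g}.
Proof.
apply/within_continuousP => x xab e e0.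
have /(is_mdP _ _ xab)/(_ 1 ltr01)[d d0 Hd] := gm xab.
pose c := `|m x| + 1.
have c0 : 0 < c by rewrite /c; have := normr_ge0 (m x); lra.
exists (Num.min d (e / c)); first by rewrite lt_min d0 divr_gt0.
move=> y yab; rewrite lt_min => /andP[yd]; rewrite ltr_pdivlMr// => ye.
have := Hd y yab yd; rewrite ler_norml => /andP[_].
have := ler_norm (m x); have := normr_ge0 (y - x); rewrite /c in ye; nra.
Qed.

Hypothesis cm : {within `[a, b], continuous m}.

Lemma md_bounded : exists C, forall x, x \in `[a, b] -> m x <= C.
Proof. by have [c _ H] := EVT_max (ltW ab) cm; exists (m c). Qed.

(** A limit of nonnegative quotients. If m x < 0, the estimate with e = - m x / 2 would make |g y -
    g x| negative at a nearby y other than x, taken on the left of x unless x = a. *)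
Lemma md_ge0 x : x \in `[a, b] -> 0 <= m x.
Proof.
move=> xab; rewrite leNgt; apply/negP => mx.
have e0 : 0 < - m x / 2 by lra.
have /(is_mdP _ _ xab)/(_ _ e0)[d d0 Hd] := gm xab.
have [y yab /andP[y0 yd]] :
    exists2 y, y \in `[a, b] & (0 < `|y - x|) && (`|y - x| < d).
  move: (xab); rewrite in_itv/= => /andP[ax xb].
  have [ax'|xa] := ltP a x.
    pose r := Num.min (d / 2) (x - a).
    have r0 : 0 < r by rewrite lt_min divr_gt0//= subr_gt0.
    have rd : r <= d / 2 by rewrite ge_min lexx.
    have ra : r <= x - a by rewrite ge_min lexx orbT.
    exists (x - r); first by rewrite in_itv/=; apply/andP; split; lra.
    by rewrite addrAC subrr add0r normrN gtr0_norm//; apply/andP; split; lra.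
  have xb' : x < b by apply: le_lt_trans ab.
  pose r := Num.min (d / 2) (b - x).
  have r0 : 0 < r by rewrite lt_min divr_gt0//= subr_gt0.
  have rd : r <= d / 2 by rewrite ge_min lexx.
  have ra : r <= b - x by rewrite ge_min lexx orbT.
  exists (x + r); first by rewrite in_itv/=; apply/andP; split; lra.
  by rewrite addrAC subrr add0r gtr0_norm//; apply/andP; split; lra.
have := Hd y yab yd; rewrite ler_norml => /andP[_].
by have := normr_ge0 (g y - g x); nra.
Qed.

(** By [segment_induction], finite covers being concatenated. A short interval around a zero of m is
    covered by its own image, which is small by the Lipschitz bound; a short interval around a point
    with m > 0 contains no zero and needs no set. *)
Lemma md_zero_cover (d e : R) : 0 < d -> 0 < e -> exists s : seq (set X),
  [/\ forall k, (diam (nth set0 s k) <= d%:E)%E,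
      (\sum_(E <- s) diam E <= (e * (b - a))%:E)%E &
      forall x, x \in `[a, b] -> m x = 0 -> exists k, nth set0 s k (g x)].
Proof.
move=> d0 e0.
pose P y z := exists s : seq (set X),
  [/\ forall k, (diam (nth set0 s k) <= d%:E)%E,
      (\sum_(E <- s) diam E <= (e * (z - y))%:E)%E &
      forall x, x \in `[y, z] -> m x = 0 -> exists k, nth set0 s k (g x)].
apply: (@segment_induction _ a b P); first exact: ltW.
  move=> x y z ax xy yz zb [s [s1 s2 s3]] [t [t1 t2 t3]].
  exists (s ++ t); split.
  - by move=> k; rewrite nth_cat; case: ifP.
  - rewrite big_cat/=; apply: le_trans (leeD s2 t2) _.
    by rewrite -EFinD lee_fin; nra.
  - move=> u; rewrite in_itv/= => /andP[xu uz] mu.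
    have [uy|yu] := leP u y.
      have [|k Hk] := s3 u _ mu; first by rewrite in_itv/= xu.
      exists k; rewrite nth_cat; case: ifPn => //; rewrite -leqNgt => sk.
      by rewrite nth_default in Hk.
    have [|k Hk] := t3 u _ mu; first by rewrite in_itv/= uz ltW.
    exists (size s + k)%N; rewrite nth_cat ltnNge leq_addr/=.
    by rewrite addnC addnK.
move=> x xab; have := md_ge0 xab; rewrite le_eqVlt => /predU1P[mx|mx].
  (* The bound e controls the sum of the diameters, and d / (b - a) keeps each diameter below d. *)
  pose e' := Num.min e (d / (b - a)).
  have e'0 : 0 < e' by rewrite lt_min e0 divr_gt0// subr_gt0.
  have /within_continuousP/(_ x xab e' e'0)[r r0 Hr] := cm.
  exists r => // y z yab zab yx xz zy.
  exists [:: g @` `[y, z]%classic]; rewrite big_seq1.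
  have /andP[ax xb] : a <= x <= b by move: xab; rewrite in_itv.
  have sub u : u \in `[y, z] -> u \in `[a, b].
    by rewrite in_itv/=; exact: segment_convex.
  have yz : 0 <= z - y by rewrite subr_ge0 (le_trans yx xz).
  have D : (diam (g @` `[y, z]%classic) <= (e' * (z - y))%:E)%E.
    apply: diam_le; first by rewrite lee_fin mulr_ge0// ltW.
    move=> _ _ [p pyz <-] [q qyz <-].
    rewrite lee_fin; apply: (@le_trans _ _ (e' * `|p - q|)).
      apply: md_dist_le; try exact: sub.
      move=> u Hu; have uyz : u \in `[y, z] by apply: segment_minmax Hu.
      have := Hr u (sub _ uyz) (dist_segment_lt yx xz zy uyz).
      rewrite -mx subr0.
      by apply: le_trans; exact: ler_norm.
    by rewrite ler_pM2l// dist_segment_le.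
  split.
  - case=> [|k]/=; last by rewrite nth_nil diam0 lee_fin ltW.
    apply: le_trans D _; rewrite lee_fin.
    have : e' <= d / (b - a) by rewrite ge_min lexx orbT.
    rewrite ler_pdivlMr ?subr_gt0// => H.
    apply: le_trans H; rewrite ler_pM2l//.
    move: yab zab; rewrite !in_itv/= => /andP[ay _] /andP[_ zb].
    by rewrite lerB.
  - by apply: le_trans D _; rewrite lee_fin ler_wpM2r// ge_min lexx.
  - by move=> u yuz mu; exists 0%N; exists u.
have mx2 : 0 < m x / 2 by lra.
have /within_continuousP/(_ x xab _ mx2)[r r0 Hr] := cm.
exists r => // y z yab zab yx xz zy.
exists [::]; split.
- by move=> k; rewrite nth_nil diam0 lee_fin ltW.
- by rewrite big_nil lee_fin mulr_ge0//; lra.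
- move=> u; rewrite in_itv/= => /andP[yu uz] mu.
  move: yab zab; rewrite !in_itv/= => /andP[ay yb] /andP[az zb].
  have := Hr u; rewrite in_itv/= mu sub0r normrN (gtr0_norm mx).
  move=> /(_ _ _)/wrap[].
  + by apply/andP; split; lra.
  + by rewrite ltr_norml; apply/andP; split; lra.
  + lra.
Qed.

Variables (h : R -> R) (f : R -> X).
Hypothesis hab : forall y, y \in `[a, b] -> h y \in `[a, b].
Hypothesis ch : {within `[a, b], continuous h}.
Hypothesis hinj : {in `[a, b] &, injective h}.
Hypothesis fE : forall y, y \in `[a, b] -> f y = g (h y).

(** A continuous injection on a segment is monotone, and distances along a monotone function add up
    in either direction. *)
Lemma homeo_distD u p w : a <= u -> u <= p -> p <= w -> w <= b ->
  `|h p - h u| + `|h w - h p| = `|h w - h u|.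
Proof.
move=> au up pw wb.
have uab : u \in `[a, b] by rewrite in_itv/=; apply/andP; split; lra.
have pab : p \in `[a, b] by rewrite in_itv/=; apply/andP; split; lra.
have wab : w \in `[a, b] by rewrite in_itv/=; apply/andP; split; lra.
have [hab'|/ltW hba] := leP (h a) (h b).
  have M := segment_continuous_inj_le hab' ch hinj.
  have hup : h u <= h p by rewrite M.
  have hpw : h p <= h w by rewrite M.
  by rewrite !ger0_norm//; lra.
have M := segment_continuous_inj_ge hba ch hinj.
have hup : h p <= h u by rewrite M.
have hpw : h w <= h p by rewrite M.
by rewrite !ler0_norm//; lra.
Qed.

(** The chord bounds sum over a partition because the increments of h telescope by [homeo_distD]. *)
Lemma total_vvariation_homeo_le S y z : a <= y -> y <= z -> z <= b ->
  (forall u w, u \in `[y, z] -> w \in `[y, z] ->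
     `|f w - f u| <= S * `|h w - h u|) ->
  (total_vvariation y z f <= (S * `|h z - h y|)%:E)%E.
Proof.
move=> ay yz zb H; apply: total_vvariation_le => s; rewrite lee_fin.
elim: s y ay yz H => [|p s ih] y ay yz H.
  by move=> /itv_partition_nilP ->; rewrite vvariation_nil subrr normr0 mulr0.
move=> /itv_partition_consP[yp ps]; have pz := itv_partition_le ps.
have hD := homeo_distD ay (ltW yp) pz zb.
rewrite vvariation_cons -hD mulrDr; apply: lerD.
  by apply: H; rewrite in_itv/=; apply/andP; split; lra.
apply: ih => //; first lra.
by move=> u w; rewrite !in_itv/= => /andP[pu uz] /andP[pw wz];
  apply: H; rewrite in_itv/=; apply/andP; split; lra.
Qed.

Lemma homeo_bounded_variation : (total_vvariation a b f < +oo)%E.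
Proof.
have [C HC] := md_bounded.
apply: le_lt_trans (@total_vvariation_homeo_le C a b _ _ _ _) _ => //;
  last 2 first.
- move=> u w uab wab; rewrite !fE//; apply: md_dist_le; try exact: hab.
  by move=> x Hx; apply: HC; exact: segment_minmax (hab uab) (hab wab) Hx.
- by rewrite ltry.
- exact: ltW.
Qed.

(** Write mu = m (h z) and let H be the increment of |h|. Near z the chord of f is at least (mu -
    eta) H and the variation at most (mu + eta) H, while the chord never exceeds the variation. *)
Lemma homeo_metrically_regular z : z \in `[a, b] -> 0 < m (h z) ->
  metrically_regular a b f z.
Proof.
move=> zab mz; split => //; apply/cvgrPdist_le => e e0.
set mu := m (h z) in mz *.
(* The bound mu / 2 makes the chord, hence the denominator, positive; the bound mu * e / 2 is what
   [onem_ratio_le] requires. *)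
pose eta := Num.min (mu / 2) (mu * e / 2).
have eta0 : 0 < eta by rewrite lt_min !divr_gt0// mulr_gt0.
have eta1 : eta <= mu / 2 by rewrite ge_min lexx.
have eta2 : eta <= mu * e / 2 by rewrite ge_min lexx orbT.
have /(is_mdP _ _ (hab zab))/(_ _ eta0)[d1 d10 H1] := gm (hab zab).
have /within_continuousP/(_ _ (hab zab) _ eta0)[d2 d20 H2] := cm.
have d120 : 0 < Num.min d1 d2 / 2 by rewrite divr_gt0// lt_min d10.
have /within_continuousP/(_ _ zab _ d120)[d d0 Hd] := ch.
have close y : y \in `[a, b] -> `|y - z| < d ->
    `|h y - h z| < d1 /\ `|h y - h z| < d2.
  move=> yab /(Hd y yab) Hy.
  have : Num.min d1 d2 <= d1 by rewrite ge_min lexx.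
  have : Num.min d1 d2 <= d2 by rewrite ge_min lexx orbT.
  by split; lra.
have V_le u w : u \in `[a, b] -> w \in `[a, b] -> u <= w ->
    `|u - z| < d -> `|w - z| < d ->
    `|f w - f u| <= fine (total_vvariation u w f) /\
    fine (total_vvariation u w f) <= (mu + eta) * `|h w - h u|.
  move=> uab wab uw uz wz.
  have : (total_vvariation u w f <= ((mu + eta) * `|h w - h u|)%:E)%E.
    move: (uab) (wab); rewrite !in_itv/= => /andP[au ub] /andP[aw wb].
    apply: total_vvariation_homeo_le => // p q; rewrite !in_itv/= => Hp Hq.
    have pab : p \in `[a, b] by exact: segment_convex Hp.
    have qab : q \in `[a, b] by exact: segment_convex Hq.
    have [_ hp] := close _ pab (dist_convex uz wz Hp).
    have [_ hq] := close _ qab (dist_convex uz wz Hq).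
    rewrite !fE//; apply: md_dist_le; try exact: hab.
    move=> x Hx.
    have := H2 x (segment_minmax (hab pab) (hab qab) Hx) (dist_minmax hp hq Hx).
    by rewrite ler_norml -/mu lerBlDl => /andP[].
  have := dist_le_total_vvariation f uw.
  by case: total_vvariation => [r||]//; rewrite !lee_fin.
apply/nbhs_deltaP; exists d => // t; rewrite subr0 => td t0 /= ztab.
have zd : `|z - z| < d by rewrite subrr normr0.
have td' : `|z + t - z| < d by rewrite addrAC subrr add0r.
have [Vl Vr] :
    `|f (z + t) - f z| <= `|fine (oriented_vvariation z (z + t) f)| /\
    `|fine (oriented_vvariation z (z + t) f)| <=
      (mu + eta) * `|h (z + t) - h z|.
  rewrite /oriented_vvariation; case: (leP z (z + t)) => [zt|/ltW zt].
    have [l r] := V_le _ _ zab ztab zt zd td'.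
    by rewrite (ger0_norm (le_trans (normr_ge0 _) l)).
  have [l r] := V_le _ _ ztab zab zt td' zd.
  rewrite fineN normrN (ger0_norm (le_trans (normr_ge0 _) l)).
  by rewrite distrC [X in _ /\ _ <= _ * X]distrC.
have [ht _] := close _ ztab td'.
have := H1 _ (hab ztab) ht; rewrite -!fE// ler_norml => /andP[Hl _].
have hgt : 0 < `|h (z + t) - h z|.
  rewrite normr_gt0 subr_eq0; apply/eqP => /(hinj ztab zab) /eqP.
  by rewrite addrC -subr_eq0 addrK => /eqP t0'; rewrite t0' eqxx in t0.
rewrite -/mu in Hl; set V := `|fine _| in Vl Vr *.
set H := `|h _ - _| in Vr Hl hgt; set D := `|f _ - _| in Vl Hl *.
have HD : (mu - eta) * H <= D by rewrite mulrBl [leLHS]addrC -lerBrDr.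
have D0 : 0 < D.
  apply: lt_le_trans HD; rewrite mulr_gt0// subr_gt0 (le_lt_trans eta1)//.
  by rewrite ltr_pdivrMr// ltr_pMr// ltr1n.
have V0 := lt_le_trans D0 Vl.
rewrite ger0_norm ?subr_ge0 ?ler_pdivrMr// ?mul1r//.
rewrite lerBlDr -lerBlDl ler_pdivlMr//.
(* For e >= 1 the lower bound is trivial; otherwise 1 - e is positive and may multiply
   inequalities. *)
have [e1|e1] := leP 1 e.
  by apply: le_trans (ltW D0); rewrite mulr_le0_ge0 ?(ltW V0)// subr_le0.
have le1 : (1 - e) * V <= (1 - e) * ((mu + eta) * H).
  by rewrite ler_wpM2l// subr_ge0 ltW.
have le2 : (1 - e) * ((mu + eta) * H) <= (mu - eta) * H.
  by rewrite mulrA ler_pM2r//; exact: onem_ratio_le.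
exact: le_trans le1 (le_trans le2 HD).
Qed.

Lemma homeo_singular_null :
  hausdorff1 (f @` metrically_singular_set a b f) = 0%E.
Proof.
apply/hausdorff1_eq0P => d e d0 e0.
have ba0 : 0 < b - a by rewrite subr_gt0.
have [s [s1 s2 s3]] := md_zero_cover d0 (divr_gt0 e0 ba0).
(* The endpoints always belong to M and cost two singletons of diameter 0, which shift the cover [s]
   by two indices. *)
exists (nth set0 [:: [set f a], [set f b] & s]); split.
- by case=> [|[|k]]//=; rewrite diam1 lee_fin ltW.
- move=> _ [y [yab Hy] <-].
  have [->|ya] := eqVneq y a; first by exists 0%N.
  have [->|yb] := eqVneq y b; first by exists 1%N.
  have [k Hk] : exists k, nth set0 s k (g (h y)).
    apply: s3; first exact: hab.
    apply: contrapT => my; apply: Hy.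
    (* If m (h y) were positive, m o h would be positive on an interval around y inside [a, b]; all
       its points would be regular, so y would not be singular. *)
    have {}my : 0 < m (h y).
      by rewrite lt_neqAle eq_sym (md_ge0 (hab yab)) andbT; apply/eqP.
    have my2 : 0 < m (h y) / 2 by lra.
    have /within_continuousP/(_ _ (hab yab) _ my2)[d1 d10 H1] := cm.
    have d12 : 0 < d1 / 2 by lra.
    have /within_continuousP/(_ _ yab _ d12)[d2 d20 H2] := ch.
    move: (yab); rewrite in_itv/= => /andP[ay by'].
    have {}ya : a < y by rewrite lt_neqAle eq_sym ya.
    have {}yb : y < b by rewrite lt_neqAle yb.
    pose r := Num.min d2 (Num.min (y - a) (b - y)).
    have r0 : 0 < r by rewrite !lt_min d20 !subr_gt0 ya yb.
    have r2 : r <= d2 by rewrite ge_min lexx.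
    have ra : r <= y - a by rewrite !ge_min lexx orbT.
    have rb : r <= b - y by rewrite !ge_min lexx !orbT.
    have sub u : `]y - r, y + r[%classic u -> u \in `[a, b].
      by rewrite /= !in_itv/= => /andP[? ?]; apply/andP; split; lra.
    exists r; split => //; right => u Hu; have uab := sub _ Hu.
    apply: homeo_metrically_regular => //.
    have /(H2 _ uab) hu : `|u - y| < d2.
      move: Hu; rewrite /= in_itv/= => /andP[? ?].
      by rewrite ltr_norml; apply/andP; split; lra.
    have /(H1 _ (hab uab)) : `|h u - h y| < d1 by lra.
    by rewrite ler_norml => /andP[+ _]; lra.
  by exists k.+2 => //=; rewrite fE.
- rewrite nneseries_diam_seq !big_cons !diam1 !add0e; apply: le_trans s2 _.
  by rewrite mulfVK// gt_eqF.
Qed.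

End continuous_metric_derivative.

(** * Images of null sets under arc length *)

Lemma lebesgue_measure_segment {R : realType} (x y : R) : x <= y ->
  lebesgue_measure `[x, y]%classic = (y - x)%:E.
Proof.
move=> xy; rewrite lebesgue_measure_itv/= lte_fin; case: ifPn => //.
by rewrite -leNgt => yx; have -> : y = x; [lra|rewrite subrr].
Qed.

Lemma le_lebesgue_measure {R : realType} (A B : set (measurableTypeR R)) :
  measurable A -> measurable B -> A `<=` B ->
  (lebesgue_measure A <= lebesgue_measure B)%E.
Proof. by move=> mA mB AB; apply: le_measure; rewrite ?inE. Qed.

Section connected_cover.
Context {R : realType} {X : normedModType R}.

(** The map u -> |u - c| is 1-Lipschitz, so it sends E into a closed interval no longer than the
    diameter of E. If the diameter is infinite, the whole line serves. *)
Lemma dist_image_cover (c : X) (E : set X) : exists J : set R,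
  [/\ measurable J, forall u, E u -> J `|u - c| &
      (lebesgue_measure J <= diam E)%E].
Proof.
have [dE|dE] := eqVneq (diam E) +oo%E.
  by exists setT; split => //; rewrite dE leey.
have [->|/set0P[u0 Eu0]] := eqVneq E set0.
  by exists set0; split => //; rewrite measure0 diam_ge0.
have Dfin : diam E \is a fin_num by rewrite ge0_fin_numE ?diam_ge0// ltey.
pose D := fine (diam E); pose S := [set `|u - c| | u in E].
have HD u w : E u -> E w -> `|u - c| - D <= `|w - c|.
  move=> Eu Ew; have := dist_le_diam Eu Ew; rewrite -(fineK Dfin) lee_fin -/D.
  have := ler_distD w u c; lra.
have S0 : S !=set0 by exists `|u0 - c|; exists u0.
have Slb : has_lbound S.
  by exists (`|u0 - c| - D) => _ [u Eu <-]; exact: HD.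
have Sub : has_ubound S.
  by exists (`|u0 - c| + D) => _ [u Eu <-]; have := HD _ _ Eu Eu0; lra.
have SD : sup S <= inf S + D.
  apply: ge_sup => // _ [u Eu <-]; rewrite -lerBlDr.
  by apply: lb_le_inf => // _ [w Ew <-]; exact: HD.
have IS : inf S <= sup S.
  by apply: (@le_trans _ _ `|u0 - c|);
    [apply: ge_inf => //|apply: ub_le_sup => //]; exists u0.
exists `[inf S, sup S]%classic; split.
- exact: measurable_itv.
- move=> u Eu /=; rewrite in_itv/=; apply/andP; split.
    by apply: ge_inf => //; exists u.
  by apply: ub_le_sup => //; exists u.
- by rewrite lebesgue_measure_segment// -(fineK Dfin) lee_fin -/D; lra.
Qed.

(** By the intermediate value theorem |f x - f p| takes every value in [0, |f q - f p|]. The sets of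
    [dist_image_cover] thus cover this interval, and subadditivity of Lebesgue measure concludes. *)
Lemma dist_le_cover (f : R -> X) p q (E F : (set X)^nat) : p <= q ->
  {within `[p, q], continuous f} ->
  (forall x, x \in `[p, q] ->
     (exists k, E k (f x)) \/ (exists k, F k (f x))) ->
  (`|f q - f p|%:E <=
     \sum_(0 <= k <oo) diam (E k) + \sum_(0 <= k <oo) diam (F k))%E.
Proof.
move=> pq cf HEF.
have /choice[J HJ] := fun k => dist_image_cover (f p) (E k).
have /choice[K HK] := fun k => dist_image_cover (f p) (F k).
have JKm k : measurable (J k `|` K k).
  by apply: measurableU; [case: (HJ k)|case: (HK k)].
pose psi x := `|f x - f p|.
have cpsi : {within `[p, q], continuous psi}.
  apply/(@within_continuousP R R) => x xpq e e0.
  have /within_continuousP/(_ x xpq e e0)[d d0 Hd] := cf.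
  exists d => // y ypq yx; apply: le_trans (Hd y ypq yx).
  rewrite /psi; apply: le_trans (ler_dist_dist _ _) _.
  by rewrite opprB addrA subrK.
have sub : `[0, `|f q - f p|]%classic `<=` \bigcup_k (J k `|` K k).
  move=> r /=; rewrite in_itv/= => /andP[r0 rd].
  have [|x xpq <-] := @IVT _ psi p q r pq cpsi.
    by rewrite /psi subrr normr0 ge_min r0 le_max rd orbT.
  case: (HEF x xpq) => -[k Hk]; exists k => //.
    by left; case: (HJ k) => _ + _; apply.
  by right; case: (HK k) => _ + _; apply.
have -> : `|f q - f p|%:E = lebesgue_measure `[0, `|f q - f p|]%classic.
  by rewrite lebesgue_measure_segment ?subr0.
apply: le_trans (@measure_sigma_subadditive _ _ _ (@lebesgue_measure R) _ _ JKm
  (measurable_itv _) sub) _.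
rewrite -nneseriesD; try by move=> *; exact: diam_ge0.
apply: lee_nneseries => [k _ _|k _]; first exact: measure_ge0.
have [Jm _ Jd] := HJ k; have [Km _ Kd] := HK k.
apply: le_trans (_ : _ <= lebesgue_measure (J k) + lebesgue_measure (K k))%E _.
  exact: measureU2.
exact: leeD.
Qed.

End connected_cover.

(** * Lebesgue nullity of arc-length parameters with an H^1-null image *)

Section arc_null.
Context {R : realType} {X : normedModType R}.
Variables (a b : R) (f : R -> X).
Hypothesis ab : a < b.
Hypothesis cf : {within `[a, b], continuous f}.
Hypothesis bvf : (total_vvariation a b f < +oo)%E.
Local Notation v := (arc a f).
Variables (N : set R) (T : set X).
Hypothesis mN : measurable (N : set (measurableTypeR R)).
Hypothesis NT : forall x, x \in `[a, b] -> N (v x) -> T (f x).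
Hypothesis T0 : hausdorff1 T = 0%E.

(** Points x with v x in N are sent by f into T, which has covers of total diameter e/2. For the
    others, v x lies in intervals of total length at most |A| + e/2, and f is 1-Lipschitz with
    respect to v. *)
Lemma dist_le_arc_measure p q : a <= p -> p <= q -> q <= b ->
  (`|f q - f p|%:E <= lebesgue_measure (`[v p, v q]%classic `\` N))%E.
Proof.
move=> ap pq qb; set A := _ `\` N.
have mA : measurable (A : set (measurableTypeR R)).
  by apply: measurableD => //; exact: measurable_itv.
have vpq := arc_le bvf ap pq qb.
have Afin : lebesgue_measure A \is a fin_num.
  rewrite ge0_fin_numE ?measure_ge0//.
  apply: (@le_lt_trans _ _ (lebesgue_measure `[v p, v q]%classic)).
    apply: le_lebesgue_measure => //.
    exact: subDsetl.
  by rewrite lebesgue_measure_segment// ltry.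
apply/lee_addgt0Pr => e e0; have e20 : 0 < e / 2 by lra.
(* Lebesgue measure is unfolded as an infimum over covers by half-open intervals. *)
have [_ [I [mI AI] <-] HI] := lb_ereal_inf_adherent e20 Afin.
have [E [_ TE HE]] := (hausdorff1_eq0P T).1 T0 1 (e / 2) ltr01 e20.
pose F k := f @` (`[p, q]%classic `&` v @^-1` (I k)).
have sub x : x \in `[p, q] -> x \in `[a, b].
  by rewrite !in_itv/= => /andP[? ?]; apply/andP; split; lra.
have FI k : (diam (F k) <= wlength idfun (I k))%E.
  have [Ik|[[x y]/= xy Ik]] := (ocitvP _).1 (mI k).
    by rewrite /F Ik preimage_set0 setI0 image_set0 diam0 wlength0//.
  rewrite /F Ik (wlength_itv_bnd _ _ _ (ltW xy)); apply: diam_le.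
    by rewrite lee_fin subr_ge0 ltW.
  move=> _ _ [u [/sub uab +] <-] [w [/sub wab +] <-].
  rewrite /= !in_itv/= => /andP[? ?] /andP[? ?]; rewrite lee_fin.
  apply: le_trans (dist_le_arc bvf wab uab) _.
  by rewrite ler_norml; apply/andP; split; lra.
have cfpq : {within `[p, q], continuous f}.
  apply: continuous_subspaceW cf => x; exact: sub.
have := @dist_le_cover _ _ f p q E F pq cfpq.
move=> /(_ _)/wrap[].
  move=> x xpq; have xab := sub _ xpq.
  have [Nv|Nv] := pselect (N (v x)).
    by left; have [k _ Hk] := TE _ (NT xab Nv); exists k.
  right; move: (xpq); rewrite in_itv/= => /andP[px xq].
  have [|k _ Hk] := AI (v x).
    split => //=; rewrite in_itv/=; apply/andP.
    by split; apply: (arc_le bvf) => //; lra.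
  by exists k; exists x.
move=> /le_trans; apply.
have -> : e = e / 2 + e / 2 by lra.
rewrite addeC EFinD addeA; apply: leeD => //.
apply: le_trans _ (ltW HI).
by apply: lee_nneseries => [k _ _|k _]; [exact: diam_ge0|exact: FI].
Qed.

(** On each interval of the partition, splitting [v p, v r] into its parts in and off N turns
    [dist_le_arc_measure] into a bound for the part in N; these bounds are added up. *)
Lemma arc_null_vvariation s p q : a <= p -> q <= b -> itv_partition p q s ->
  (lebesgue_measure (`[v p, v q]%classic `&` N) <=
     (v q - v p - vvariation p q f s)%:E)%E.
Proof.
have mI x y : measurable (`[v x, v y]%classic `&` N : set (measurableTypeR R)).
  by apply: measurableI => //; exact: measurable_itv.
elim: s p => [|r s ih] p ap qb.
  move=> /itv_partition_nilP ->; rewrite vvariation_nil !subrr.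
  apply: (@le_trans _ _ (lebesgue_measure `[v q, v q]%classic)).
    apply: le_lebesgue_measure => //.
  by rewrite lebesgue_measure_segment// subrr.
move=> /itv_partition_consP[/ltW pr rs]; have rq := itv_partition_le rs.
have ar := le_trans ap pr; have rb := le_trans rq qb.
have vpr := arc_le bvf ap pr rb; have vrq := arc_le bvf ar rq qb.
have Hr := ih r ar qb rs.
have Hp : (lebesgue_measure (`[v p, v r]%classic `&` N) <=
     (v r - v p - `|f r - f p|)%:E)%E.
  have := dist_le_arc_measure ap pr rb.
  have := lebesgue_measure_segment vpr.
  rewrite (measureDI _ _ mN)/=; last exact: measurable_itv.
  have := measure_ge0 (@lebesgue_measure R) (`[v p, v r]%classic `&` N).
  have := measure_ge0 (@lebesgue_measure R) (`[v p, v r]%classic `\` N).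
  case: lebesgue_measure => [x||]//; case: lebesgue_measure => [y||]//.
  by rewrite -EFinD !lee_fin => _ _ [] ? ?; lra.
apply: le_trans (_ : _ <= lebesgue_measure ((`[v p, v r]%classic `&` N) `|`
    (`[v r, v q]%classic `&` N)))%E _.
  apply: le_lebesgue_measure => //; first exact: measurableU.
  move=> x [+ Nx]; rewrite /= !in_itv/= => /andP[px xq].
  by have [xr|/ltW rx] := leP x (v r); [left|right];
    split => //=; rewrite ?in_itv/=; apply/andP.
apply: le_trans (_ : _ <= lebesgue_measure (`[v p, v r]%classic `&` N) +
    lebesgue_measure (`[v r, v q]%classic `&` N))%E _; first exact: measureU2.
apply: le_trans (leeD Hp Hr) _; rewrite -EFinD lee_fin vvariation_cons; lra.
Qed.

(** A partition of [a, b] whose polygonal length is within e of the variation makes the bound of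
    [arc_null_vvariation] at most e. *)
Lemma arc_null : N `<=` v @` `[a, b]%classic -> lebesgue_measure N = 0%E.
Proof.
move=> Nv; apply/eqP; rewrite eq_le measure_ge0 andbT.
apply/lee_addgt0Pr => e e0; rewrite add0e.
have [s ps Hs] := arc_approx bvf (lexx a) (ltW ab) (lexx b) e0.
have := arc_null_vvariation (lexx a) (lexx b) ps.
have -> : `[v a, v b]%classic `&` N = N.
  apply/setIidPr => r /Nv[x + <-]; rewrite /= !in_itv/= => /andP[ax xb].
  by rewrite !(arc_le bvf).
by move=> /le_trans; apply; rewrite lee_fin; lra.
Qed.

End arc_null.

(** * A time change with prescribed infinite speed *)

Section null_weight.
Context {R : realType}.

Definition dyadic n : R := ((2 ^ n)%:R)^-1.

Lemma dyadic_gt0 n : 0 < dyadic n.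
Proof. by rewrite invr_gt0 ltr0n expn_gt0. Qed.

Lemma dyadic_le m n : (m <= n)%N -> dyadic n <= dyadic m.
Proof.
by move=> mn; rewrite lef_pV2 ?posrE ?ltr0n ?expn_gt0// ler_nat leq_pexp2l.
Qed.

Lemma dyadic_le1 n : dyadic n <= 1.
Proof. by have := dyadic_le (leq0n n); rewrite {2}/dyadic expn0 invr1. Qed.

Lemma dyadic_small e : 0 < e -> exists n, dyadic n <= e.
Proof.
move=> e0; have [n Hn] : exists n : nat, e^-1 <= n%:R.
  by exists (Num.bound e^-1); apply/ltW/archi_boundP; rewrite invr_ge0 ltW.
exists n; rewrite -[e]invrK lef_pV2 ?posrE ?invr_gt0 ?ltr0n ?expn_gt0//.
by apply: le_trans Hn _; rewrite ler_nat ltnW// ltn_expl.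
Qed.

(** Choose open sets G n around N of measure at most 4^-(n+1) and Urysohn functions theta n, equal
    to 0 on N and 1 off G n; rho is the supremum of 2^-n * theta n. The measures are small enough
    for 1 / rho to be integrable. *)
Lemma null_weight (N : set R) : closed N -> lebesgue_measure N = 0%E ->
  exists (rho : R -> R) (G : nat -> set R),
  [/\ forall (s e : R), 0 < e -> exists2 d : R, 0 < d &
        forall t, `|t - s| < d -> `|rho t - rho s| <= e,
      forall s, 0 <= rho s <= 1, forall s, N s -> rho s = 0,
      forall n, open (G n) /\
        (lebesgue_measure (G n) <= (dyadic n.+1 * dyadic n.+1)%:E)%E &
      forall n s, ~ G n s -> dyadic n <= rho s].
Proof.
move=> cN N0.
have /choice[G HG] n : exists U : set R, [/\ open U, N `<=` U &
    (lebesgue_measure U <= (dyadic n.+1 * dyadic n.+1)%:E)%E].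
  have e0 : 0 < dyadic n.+1 * dyadic n.+1 by rewrite mulr_gt0// dyadic_gt0.
  have [U [oU NU HU]] := outer_measure_open_le N e0.
  exists U; split => //; apply: le_trans HU _.
  by rewrite [X in (X + _)%E](_ : _ = lebesgue_measure N)// N0 add0e.
have /choice[theta Ht] n : exists th : R -> R, [/\ continuous th,
    forall s, 0 <= th s <= 1, forall s, N s -> th s = 0 &
    forall s, ~ G n s -> th s = 1].
  have [oG NG _] := HG n.
  have : uniform_separator N (~` G n).
    apply: (normal_uniform_separator (@pseudometric_normal R R)) => //.
    - exact: open_closedC.
    - by rewrite -subset0 => s [/NG].
  move=> /(@uniform_separatorP _ R)[th [cth th01 thN thG]].
  exists th; split => //.
  - move=> s; have : range th (th s) by exists s.
    by move=> /th01 /=; rewrite in_itv.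
  - by move=> s Ns; apply: thN; exists s.
  - by move=> s Gs; apply: thG; exists s.
pose S s := [set dyadic n * theta n s | n in [set: nat]].
pose rho s := sup (S s).
have th0 n s : 0 <= theta n s by have [_ /(_ s)/andP[]] := Ht n.
have th1 n s : theta n s <= 1 by have [_ /(_ s)/andP[]] := Ht n.
have Sle n s : dyadic n * theta n s <= dyadic n.
  by rewrite -[leRHS]mulr1 ler_pM2l ?dyadic_gt0.
have Sub s : has_ubound (S s).
  by exists 1 => _ [n _ <-]; exact: le_trans (Sle n s) (dyadic_le1 n).
have le_rho n s : dyadic n * theta n s <= rho s.
  by apply: ub_le_sup => //; exists n.
have rho_le s c : (forall n, dyadic n * theta n s <= c) -> rho s <= c.
  move=> H; apply: ge_sup => [|_ [n _ <-]//].
  by exists (dyadic 0 * theta 0%N s), 0%N.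
have rho0 s : 0 <= rho s.
  by apply: le_trans (le_rho 0%N s); rewrite mulr_ge0// ltW// dyadic_gt0.
exists rho, G; split.
- move=> s e e0; have [K HK] := dyadic_small e0.
  have [d d0 Hd] : exists2 d : R, 0 < d & forall t, `|t - s| < d ->
      forall n, (n < K)%N -> `|theta n t - theta n s| <= e.
    elim: K {HK} => [|K [d d0 Hd]]; first by exists 1.
    have [cth _ _ _] := Ht K.
    have /cvgrPdist_le/(_ e e0)/nbhs_deltaP[d' d'0 Hd'] := cth s.
    exists (Num.min d d'); first by rewrite lt_min d0.
    move=> t; rewrite lt_min => /andP[td td'] n; rewrite ltnS leq_eqVlt.
    by move=> /predU1P[->|/Hd]; [rewrite distrC; exact: Hd'|apply].
  (* Continuity of the supremum: terms of index at least K never exceed e, so only finitely many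
     theta n have to be compared. *)
  have half t t' : (forall n, (n < K)%N -> `|theta n t - theta n t'| <= e) ->
      rho t <= rho t' + e.
    move=> H; apply: rho_le => n; have [nK|Kn] := ltnP n K.
      have := H n nK; rewrite ler_norml => /andP[_ h1].
      have := le_rho n t'; have := dyadic_le1 n; have := dyadic_gt0 n; nra.
    apply: le_trans (Sle n t) _; apply: le_trans (dyadic_le Kn) _.
    by have := rho0 t'; lra.
  exists d => // t td; have H1 := half t s (Hd t td).
  have H2 : rho s <= rho t + e.
    by apply: half => n nK; rewrite distrC; exact: Hd.
  by rewrite ler_norml; apply/andP; split; lra.
- move=> s; rewrite rho0/=; apply: rho_le => n.
  exact: le_trans (Sle n s) (dyadic_le1 n).
- move=> s Ns; apply/le_anti; rewrite rho0 andbT; apply: rho_le => n.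
  by have [_ _ -> // _] := Ht n; rewrite mulr0.
- by move=> n; have [] := HG n.
- move=> n s Gs; apply: le_trans (le_rho n s).
  by have [_ _ _ ->//] := Ht n; rewrite mulr1.
Qed.

End null_weight.

(** * The primitive of the reciprocal of the weight *)

Section clock.
Context {R : realType}.
Local Notation mu := (@lebesgue_measure R).
Variables (rho : R -> R) (G : nat -> set R).
Hypothesis crho : forall (s e : R), 0 < e -> exists2 d : R, 0 < d &
  forall t, `|t - s| < d -> `|rho t - rho s| <= e.
Hypothesis rho01 : forall s, 0 <= rho s <= 1.
Hypothesis oG : forall n, open (G n).
Hypothesis muG : forall n, (mu (G n) <= (@dyadic R n.+1 * @dyadic R n.+1)%:E)%E.
Hypothesis rhoG : forall n s, ~ G n s -> @dyadic R n <= rho s.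
Variables (l r : R).
Hypothesis lr : l <= r.

Lemma continuous_rho : continuous rho.
Proof.
move=> s; apply/cvgrPdist_le => e e0; apply/nbhs_deltaP.
by have [d d0 Hd] := crho s e0; exists d => // t td; rewrite distrC; exact: Hd.
Qed.

Let q s := (rho s)^-1.

Let q0 s : 0 <= q s.
Proof. by rewrite invr_ge0; case/andP: (rho01 s). Qed.

Lemma measurable_rho D : measurable_fun (D : set (measurableTypeR R)) rho.
Proof.
apply: measurable_funTS; apply: continuous_measurable_fun.
exact: continuous_rho.
Qed.

Lemma open_rho_neq0 : open [set s | rho s != 0].
Proof.
apply: (@open_comp _ _ rho [set x | x != 0]); last exact: open_neq.
by move=> s _; exact: continuous_rho.
Qed.

(** The function q is continuous on the open set where rho is nonzero, and equal to the default
    value 0 elsewhere. *)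
Lemma measurable_invr_rho D : measurable D ->
  measurable_fun (D : set (measurableTypeR R)) q.
Proof.
move=> mD; apply: (@measurable_funS _ _ _ _ setT) => //.
pose U := [set s | rho s != 0].
have oU : open U := open_rho_neq0.
have mU : measurable (U : set (measurableTypeR R)) := open_measurable oU.
rewrite -(setUv U); apply/measurable_funU => //; first exact: measurableC.
split.
  apply: open_continuous_measurable_fun => // s; rewrite inE => Us.
  by apply: cvgV => //; exact: continuous_rho.
apply: (eq_measurable_fun (cst (0 : R))) => [s|]; last exact: measurable_cst.
by rewrite inE /U /= => /negP; rewrite negbK /q => /eqP ->; rewrite invr0.
Qed.

Lemma measurable_G n : measurable (G n : set (measurableTypeR R)).
Proof. exact: open_measurable. Qed.

Lemma invr_rho_le s :
  ((q s)%:E <= 1 + \sum_(0 <= k <oo) ((@dyadic R k.+1)^-1 * \1_(G k) s)%:E)%E.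
Proof.
have pos k : (0 <= ((@dyadic R k.+1)^-1 * \1_(G k) s)%:E)%E.
  by rewrite lee_fin mulr_ge0// ?invr_ge0 ?ltW ?dyadic_gt0// indicE.
have [q1|q1] := leP (q s) 1.
  apply: (@le_trans _ _ 1%E); first by rewrite lee_fin.
  by rewrite leeDl// nneseries_ge0.
have [k Gk qk] : exists2 k, G k s & q s <= (@dyadic R k.+1)^-1.
  (* The inverse of 0 is 0, so q s > 1 excludes rho s = 0. *)
  have rho_gt0 : 0 < rho s.
    rewrite lt_neqAle; case/andP: (rho01 s) => -> _; rewrite andbT eq_sym.
    by apply: contraTneq q1 => r0; rewrite /q r0 invr0 -leNgt.
  have qle m : ~ G m s -> q s <= (@dyadic R m)^-1.
    by move=> /rhoG; rewrite /q lef_pV2 ?posrE ?dyadic_gt0.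
  (* If s misses some G m, descend to an index k with s in G k but not in G (k+1); missing G 0 would
     give q s <= 1. If s is in every G k, any k with 2^-k <= rho s works. *)
  have [[m nGm]|/forallNP allG] := pselect (exists m, ~ G m s).
    elim: m nGm => [/qle|m ih nGm].
      by rewrite /dyadic expn0 !invr1 leNgt q1.
    have [Gm|/ih//] := pselect (G m s).
    by exists m => //; exact: qle.
  have [k Hk] := dyadic_small rho_gt0.
  exists k; first exact: contrapT (allG k).
  rewrite /q lef_pV2 ?posrE ?dyadic_gt0//.
  exact: le_trans (dyadic_le (leqnSn k)) Hk.
apply: (@le_trans _ _
    (\sum_(0 <= k <oo) ((@dyadic R k.+1)^-1 * \1_(G k) s)%:E)%E);
  last by rewrite leeDr.
apply: le_trans (nneseries_lim_ge k.+1 _); last by move=> *; exact: pos.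
rewrite big_nat_recr//=.
apply: (@le_trans _ _ ((@dyadic R k.+1)^-1 * \1_(G k) s)%:E).
  by rewrite lee_fin indicE mem_set// mulr1.
by rewrite leeDr//; apply: sume_ge0 => i _; exact: pos.
Qed.

Lemma integrable_invr_rho : mu.-integrable `[l, r] (EFin \o q).
Proof.
have mI : measurable (`[l, r]%classic : set (measurableTypeR R)).
  exact: measurable_itv.
apply/integrableP; split.
  by apply/measurable_EFinP; exact: measurable_invr_rho.
have mG k : measurable_fun (`[l, r]%classic : set (measurableTypeR R))
    (fun s => ((@dyadic R k.+1)^-1 * \1_(G k) s)%:E).
  apply/measurable_EFinP; apply: measurable_funM => //.
  by apply: measurable_indic; exact: measurable_G.
have posG k s : (0 <= ((@dyadic R k.+1)^-1 * \1_(G k) s)%:E)%E.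
  by rewrite lee_fin mulr_ge0// ?invr_ge0 ?ltW ?dyadic_gt0// indicE.
have mS : measurable_fun (`[l, r]%classic : set (measurableTypeR R))
    (fun s => \sum_(0 <= k <oo) ((@dyadic R k.+1)^-1 * \1_(G k) s)%:E)%E.
  exact: (@ge0_emeasurable_sum _ _ _ _
    (fun k s => ((@dyadic R k.+1)^-1 * \1_(G k) s)%:E) xpredT
    (fun k s _ _ => posG k s) (fun k _ => mG k)).
apply: (@le_lt_trans _ _ (\int[mu]_(s in `[l, r])
    (1 + \sum_(0 <= k <oo) ((@dyadic R k.+1)^-1 * \1_(G k) s)%:E))%E).
  apply: ge0_le_integral => //.
  - apply/measurable_EFinP; apply: measurableT_comp => //.
    exact: measurable_invr_rho.
  - exact: emeasurable_funD.
  - by move=> s _; rewrite /= ger0_norm//; exact: invr_rho_le.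
rewrite ge0_integralD//; last by move=> s _; exact: nneseries_ge0.
rewrite integral_cst//= mul1e lebesgue_measure_segment// integral_nneseries//.
(* The k-th term integrates to at most 2^(k+1) * 4^-(k+1) = 2^-(k+1), and these bounds sum to at
   most 1. *)
apply: (@le_lt_trans _ _
    ((r - l)%:E + \sum_(0 <= k <oo) (1 / (2 ^ k.+1)%:R)%:E)%E).
  rewrite leeD2l//; apply: lee_nneseries => [k _ _|k _].
    exact: integral_ge0.
  under eq_integral do rewrite EFinM.
  rewrite ge0_integralZl_EFin//.
  - rewrite integral_indic//; last exact: measurable_G.
    apply: (@le_trans _ _ (((@dyadic R k.+1)^-1)%:E * mu (G k))%E).
      apply: lee_wpmul2l; first by rewrite lee_fin invr_ge0 ltW ?dyadic_gt0.
      apply: le_lebesgue_measure; [|exact: measurable_G|exact: subIsetl].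
      by apply: measurableI => //; exact: measurable_G.
    apply: le_trans (lee_wpmul2l _ (muG k)) _.
      by rewrite lee_fin invr_ge0 ltW ?dyadic_gt0.
    by rewrite -EFinM lee_fin mulKf ?gt_eqF ?dyadic_gt0// mul1r.
  - by apply/measurable_EFinP; apply: measurable_indic; exact: measurable_G.
  - by rewrite invr_ge0 ltW ?dyadic_gt0.
apply: (@le_lt_trans _ _ ((r - l)%:E + 1)%E); last by rewrite -EFinD ltry.
by rewrite leeD2l// epsilon_trick0.
Qed.

Lemma measurable_rho_zeros :
  measurable ([set s | rho s = 0] : set (measurableTypeR R)).
Proof.
have -> : [set s | rho s = 0] = ~` [set s | rho s != 0].
  by apply/seteqP; split => s /= => [->|/negP/negPn/eqP//]; rewrite eqxx.
by apply: measurableC; apply: open_measurable; exact: open_rho_neq0.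
Qed.

(** The zeros of rho lie in every G n, and the measures of the G n tend to 0. *)
Lemma rho_zeros_null : mu [set s | rho s = 0] = 0%E.
Proof.
apply/eqP; rewrite eq_le measure_ge0 andbT; apply/lee_addgt0Pr => e e0.
rewrite add0e; have [n Hn] := dyadic_small e0.
apply: (@le_trans _ _ (mu (G n))).
  apply: le_lebesgue_measure; last 2 first.
  - exact: measurable_G.
  - move=> s /= rs; apply: contrapT => /rhoG; rewrite rs leNgt.
    by rewrite dyadic_gt0.
  exact: measurable_rho_zeros.
apply: le_trans (muG n) _; rewrite lee_fin.
have := @dyadic_le R _ _ (leqnSn n); have := @dyadic_le1 R n.+1.
have := @dyadic_gt0 R n.+1.
nra.
Qed.

Definition clock s := parameterized_integral mu l s q.

Lemma clock_continuous : {within `[l, r], continuous clock}.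
Proof. exact: parameterized_integral_continuous integrable_invr_rho. Qed.

(** As the zeros of rho are null, rho * q = 1 almost everywhere and t - s is the integral of rho *
    q; then c * q <= rho * q <= C * q is integrated. *)
Lemma clock_bounds s t c C : l <= s -> s <= t -> t <= r ->
  (forall u, u \in `[s, t] -> c <= rho u <= C) ->
  c * (clock t - clock s) <= t - s <= C * (clock t - clock s).
Proof.
move=> ls st tr H.
have mI : measurable (`]s, t]%classic : set (measurableTypeR R)).
  exact: measurable_itv.
have intq : mu.-integrable `]s, t] (EFin \o q).
  apply: integrableS integrable_invr_rho => // u /=; rewrite !in_itv/=.
  by move=> /andP[? ?]; apply/andP; split; lra.
have -> : clock t - clock s = \int[mu]_(u in `]s, t]) q u.
  rewrite /clock /parameterized_integral Rintegral_itvB//.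
  by apply: integrableS integrable_invr_rho => // u /=; rewrite !in_itv/=;
    move=> /andP[? ?]; apply/andP; split; lra.
have mrq : measurable_fun (`]s, t]%classic : set (measurableTypeR R))
    (fun u => rho u * q u).
  apply: measurable_funM; first exact: measurable_rho.
  exact: measurable_invr_rho.
have intrq : mu.-integrable `]s, t] (EFin \o (fun u => rho u * q u)).
  apply: le_integrable intq => //; first exact/measurable_EFinP.
  move=> u _ /=; have /andP[r0 r1] := rho01 u.
  by rewrite lee_fin !ger0_norm ?mulr_ge0// ler_piMl.
have <- : \int[mu]_(u in `]s, t]) (rho u * q u) = t - s.
  rewrite /Rintegral (_ : (\int[mu]_(u in `]s, t]) _)%E = (t - s)%:E)//.
  rewrite (@ae_eq_integral _ _ _ _ _ (cst 1%E))//.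
  - rewrite integral_cst//= mul1e lebesgue_measure_itv/= lte_fin.
    case: ltP => // ts; have -> : t = s by lra.
    by rewrite subrr.
  - exact/measurable_EFinP.
  - exists [set u | rho u = 0]; split.
    + exact: measurable_rho_zeros.
    + exact: rho_zeros_null.
    + move=> u /= Hu; apply: contrapT => /eqP ru; apply: Hu => _.
      by rewrite /= /q divff.
have intZ k : mu.-integrable `]s, t] (EFin \o (fun u => k * q u)).
  apply: (@eq_integrable _ _ _ _ _ mI (fun u => k%:E * (EFin \o q) u)%E) => //.
  exact: integrableZl.
rewrite -!RintegralZl//; apply/andP; split; apply: le_Rintegral => // u /=.
  rewrite in_itv/= => /andP[su ut]; rewrite ler_wpM2r//.
  by have /andP[] : c <= rho u <= C by apply: H; rewrite in_itv/= ut ltW.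
rewrite in_itv/= => /andP[su ut]; rewrite ler_wpM2r//.
by have /andP[] : c <= rho u <= C by apply: H; rewrite in_itv/= ut ltW.
Qed.

Lemma clock_ge s t : l <= s -> s <= t -> t <= r -> t - s <= clock t - clock s.
Proof.
move=> ls st tr; have := @clock_bounds s t 0 1 ls st tr (fun u _ => rho01 u).
by rewrite mul1r => /andP[].
Qed.

(* The clock runs with speed 1 / rho, even at the zeros of rho. *)
Lemma clock_speed s e : s \in `[l, r] -> 0 < e -> exists2 d : R, 0 < d &
  forall t, t \in `[l, r] -> `|t - s| < d ->
    `| `|t - s| - rho s * `|clock t - clock s| | <= e * `|clock t - clock s|.
Proof.
move=> slr e0; have [d d0 Hd] := crho s e0; exists d => // t tlr td.
move: slr tlr; rewrite !in_itv/= => /andP[ls sr] /andP[lt tr].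
have near u : `|u - s| < d -> rho s - e <= rho u <= rho s + e.
  by move=> /Hd; rewrite ler_norml => /andP[? ?]; apply/andP; split; lra.
have [st|/ltW ts] := leP s t.
  have H1 := clock_ge ls st tr.
  rewrite (ger0_norm (_ : 0 <= t - s)) in td *; last lra.
  rewrite (ger0_norm (_ : 0 <= clock t - clock s)); last lra.
  have /(_ _)/wrap[|/andP[]] :=
    @clock_bounds s t (rho s - e) (rho s + e) ls st tr.
    move=> u; rewrite in_itv/= => /andP[su ut]; apply: near.
    by rewrite ger0_norm; lra.
  by rewrite ler_norml => ? ?; apply/andP; split; lra.
have H1 := clock_ge lt ts sr.
rewrite !(distrC _ s) !(distrC _ (clock s)) in td *.
rewrite (ger0_norm (_ : 0 <= s - t)) in td *; last lra.
rewrite (ger0_norm (_ : 0 <= clock s - clock t)); last lra.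
have /(_ _)/wrap[|/andP[]] :=
  @clock_bounds t s (rho s - e) (rho s + e) lt ts sr.
  move=> u; rewrite in_itv/= => /andP[su ut]; apply: near.
  by rewrite distrC ger0_norm; lra.
by rewrite ler_norml => ? ?; apply/andP; split; lra.
Qed.

End clock.

Lemma exists_clock {R : realType} (N : set R) (l r : R) : l <= r ->
  closed N -> lebesgue_measure N = 0%E -> exists rho w : R -> R,
  [/\ forall s e : R, 0 < e -> exists2 d : R, 0 < d &
        forall t, `|t - s| < d -> `|rho t - rho s| <= e,
      forall s, 0 <= rho s <= 1,
      forall s, N s -> rho s = 0,
      {within `[l, r], continuous w} &
      (forall s t, l <= s -> s <= t -> t <= r -> t - s <= w t - w s) /\
      forall s e : R, s \in `[l, r] -> 0 < e -> exists2 d : R, 0 < d &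
        forall t, t \in `[l, r] -> `|t - s| < d ->
          `| `|t - s| - rho s * `|w t - w s| | <= e * `|w t - w s|].
Proof.
move=> lr cN /(null_weight cN)[rho [G]].
move=> [crho rho01 rhoN /all_and2[oG muG] rhoG].
exists rho, (clock rho l); split => //.
  exact (clock_continuous crho rho01 oG muG rhoG lr).
split; first by move=> s t; exact: (clock_ge crho rho01 oG muG rhoG lr).
by move=> s e; exact: (clock_speed crho rho01 oG muG rhoG lr).
Qed.

(** * The singular set *)

Section singular_set.
Context {R : realType} {X : normedModType R}.
Variables (a b : R) (f : R -> X).
Hypothesis ab : a < b.
Hypothesis cf : {within `[a, b], continuous f}.
Hypothesis bvf : (total_vvariation a b f < +oo)%E.
Local Notation v := (arc a f).
Local Notation M := (metrically_singular_set a b f).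

Lemma singular_closed : closed M.
Proof.
rewrite -[M]setCK; apply: open_closedC; rewrite openE => x /= Mx.
apply/nbhs_deltaP.
have [xab|xab] := boolP (x \in `[a, b]); last first.
  have : nbhs x (~` `[a, b]%classic).
    apply: open_nbhs_nbhs; split; last exact/negP.
    by apply: closed_openC; exact: itv_closed.
  move=> /nbhs_deltaP[d d0 Hd]; exists d => // y /Hd yab [yab' _].
  exact: yab.
have /contrapT[d [d0 sub H]] : ~ ~ exists delta : R,
    let U := `]x - delta, x + delta[%classic in
    [/\ 0 < delta, U `<=` `[a, b]%classic
      & (forall y z, U y -> U z -> f y = f z) \/
        (forall y, U y -> metrically_regular a b f y)].
  by move=> H; apply: Mx.
exists d => // y; rewrite ltr_norml => /andP[dy yd] [yab]; apply.
(* The largest radius for which the interval around y stays inside the one around x. *)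
pose d' := Num.min (y - (x - d)) (x + d - y).
have d1 : d' <= y - (x - d) by rewrite ge_min lexx.
have d2 : d' <= x + d - y by rewrite ge_min lexx orbT.
have d'0 : 0 < d' by rewrite lt_min; apply/andP; split; lra.
have sub' : `]y - d', y + d'[%classic `<=` `]x - d, x + d[%classic.
  by move=> z; rewrite /= !in_itv/= => /andP[? ?]; apply/andP; split; lra.
exists d'; split => //; first exact: subset_trans sub.
case: H => H; last by right => u /sub'; exact: H.
by left => u w /sub' Uu /sub' Uw; exact: H.
Qed.

(** The continuous image of a compact set. Closedness makes v(M) measurable and lets [exists_clock]
    apply to it. *)
Lemma arc_singular_closed : closed (v @` M).
Proof.
apply: compact_closed; first exact: Rhausdorff.
have MI : M `<=` `[a, b]%classic by move=> x [].
apply: continuous_compact.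
  exact: continuous_subspaceW MI (arc_continuous bvf cf).
exact: subclosed_compact singular_closed (@segment_compact _ a b) MI.
Qed.

Lemma arc_eq x y : x \in `[a, b] -> y \in `[a, b] -> v x = v y -> f x = f y.
Proof.
move=> xab yab vxy; have := dist_le_arc bvf xab yab.
by rewrite vxy subrr normr0 normr_le0 subr_eq0 => /eqP.
Qed.

(** [arc_null] applies with T = f(M), because f factors through v: if v x is in v(M), then f x is in
    f(M). *)
Lemma arc_singular_null : hausdorff1 (f @` M) = 0%E ->
  lebesgue_measure (v @` M) = 0%E.
Proof.
move=> H0; apply: (@arc_null _ _ a b f ab cf bvf _ (f @` M)) => //.
- by apply: closed_measurable; exact: arc_singular_closed.
- move=> x xab [y [yab My] vyx]; exists y => //; exact: arc_eq.
- by move=> _ [y [yab _] <-]; exists y.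
Qed.

(** The union of the open intervals inside [a, b] on which f is constant. *)
Definition locally_constant_set : set R :=
  [set x | exists2 d : R, 0 < d &
    forall y, `|y - x| < d -> y \in `[a, b] /\ f y = f x].
Local Notation Z := locally_constant_set.

Lemma locally_constant_open : open Z.
Proof.
rewrite openE => x [d d0 Hd]; apply/nbhs_deltaP; exists (d / 2); first lra.
move=> y yx; exists (d / 2); first lra.
have fy : f y = f x by apply: (Hd y _).2; lra.
move=> z zy; rewrite fy; apply: Hd.
by have := ler_distD y z x; lra.
Qed.

Lemma locally_constant_arc x : Z x -> exists2 d : R, 0 < d &
  forall y, `|y - x| < d -> y \in `[a, b] /\ v y = v x.
Proof.
move=> [d d0 Hd]; exists d => // y yx; split; first by case: (Hd y yx).
have [yab fy] := Hd y yx; have [xab _] : x \in `[a, b] /\ f x = f x.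
  by apply: Hd; rewrite subrr normr0.
move: (yab) (xab); rewrite !in_itv/= => /andP[ay yb] /andP[ax xb].
move: yx; rewrite ltr_norml => /andP[d1 d2].
have const z : Num.min x y <= z <= Num.max x y -> f z = f x.
  rewrite ge_min le_max => Hz; apply: (Hd z _).2; rewrite ltr_norml.
  by case/andP: Hz => /orP[] ? /orP[] ?; apply/andP; split; lra.
have [xy|/ltW yx] := leP x y.
  rewrite min_l// max_r// in const.
  apply/esym/(arc_const bvf) => // z; rewrite in_itv/=; exact: const.
rewrite min_r// max_l// in const.
apply: (arc_const bvf) => // z; rewrite in_itv/= => Hz.
by rewrite fy; exact: const.
Qed.

Lemma regular_not_locally_constant x : metrically_regular a b f x -> ~ Z x.
Proof.
move=> Rx /locally_constant_arc[d d0 Hd].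
have [d' d'0 Hd'] := metrically_regularP bvf Rx ltr01.
pose t := Num.min d d' / 2.
have t0 : 0 < t by rewrite divr_gt0// lt_min d0.
have t1 : t <= d / 2 by rewrite /t ler_pM2r// ge_min lexx.
have t2 : t <= d' / 2 by rewrite /t ler_pM2r// ge_min lexx orbT.
have [yab vy] : x + t \in `[a, b] /\ v (x + t) = v x.
  by apply: Hd; rewrite addrAC subrr add0r gtr0_norm//; lra.
have [] := Hd' _ yab; last by rewrite vy eqxx.
  by rewrite -subr_eq0 addrAC subrr add0r gt_eqF.
by rewrite addrAC subrr add0r gtr0_norm//; lra.
Qed.

(* The left endpoint of a maximal interval of constancy is singular. *)
Lemma locally_constant_arc_singular y : Z y -> (v @` M) (v y).
Proof.
move=> Zy; have [d d0 Hd] := locally_constant_arc Zy.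
have [yab _] : y \in `[a, b] /\ v y = v y by apply: Hd; rewrite subrr normr0.
move: (yab); rewrite in_itv/= => /andP[ay yb].
(* Its infimum c is the left end of the interval of constancy of v through y. *)
pose S := [set x | a <= x <= y /\ v x = v y].
have Sy : S y by split => //; rewrite ay lexx.
have Slb : has_lbound S by exists a => x [/andP[]].
have hS : has_inf S by split; [exists y|].
pose c := inf S.
have ac : a <= c by apply: lb_le_inf; [exists y|move=> x [/andP[]]].
have cy : c <= y by apply: ge_inf.
have vc x : c < x -> x <= y -> v x = v y.
  move=> cx xy; have xc : 0 < x - c by rewrite subr_gt0.
  have [x' [/andP[ax' x'y] vx'] xx'] := inf_adherent xc hS.
  rewrite -/c addrC subrK in xx'.
  apply/le_anti/andP; split; first by apply: (arc_le bvf) => //; lra.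
  by rewrite -vx'; apply: (arc_le bvf); lra.
have cy' : c < y.
  have [yd vd] : y - d / 2 \in `[a, b] /\ v (y - d / 2) = v y.
    by apply: Hd; rewrite addrAC subrr add0r normrN gtr0_norm; lra.
  move: yd; rewrite in_itv/= => /andP[ayd _].
  apply: (@le_lt_trans _ _ (y - d / 2)); last lra.
  by apply: ge_inf => //; split => //; apply/andP; split; lra.
have cab : c \in `[a, b] by rewrite in_itv/=; apply/andP; split; lra.
have vcy : v c = v y.
  apply/eqP; rewrite -subr_eq0 -normr_le0; apply/ler_addgt0Pr => e e0.
  rewrite add0r.
  have /within_continuousP/(_ c cab e e0)[r r0 Hr] := arc_continuous bvf cf.
  pose t := Num.min (r / 2) (y - c).
  have t0 : 0 < t by rewrite lt_min divr_gt0//= subr_gt0.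
  have t1 : t <= r / 2 by rewrite ge_min lexx.
  have t2 : t <= y - c by rewrite ge_min lexx orbT.
  have := Hr (c + t); rewrite (distrC (v _)) (vc (c + t)); [|lra..]; apply.
    by rewrite in_itv/=; apply/andP; split; lra.
  by rewrite addrAC subrr add0r gtr0_norm//; lra.
(* A non-singular c would be locally constant, which would put points left of c into S, or regular,
   which is impossible since v is constant on [c, y]. *)
exists c => //; split => // -[r [r0 sub H]].
have ra : a <= c - r / 2.
  have : `[a, b]%classic (c - r / 2).
    by apply: sub; rewrite /= in_itv/=; apply/andP; split; lra.
  by rewrite /= in_itv/= => /andP[].
have Zc_false : ~ Z c.
  move=> /locally_constant_arc[d' d'0 Hd'].
  pose t := Num.min d' r / 2.
  have t0 : 0 < t by rewrite divr_gt0// lt_min d'0.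
  have t1 : t <= d' / 2 by rewrite /t ler_pM2r// ge_min lexx.
  have t2 : t <= r / 2 by rewrite /t ler_pM2r// ge_min lexx orbT.
  have [ctab vct] : c - t \in `[a, b] /\ v (c - t) = v c.
    by apply: Hd'; rewrite addrAC subrr add0r normrN gtr0_norm//; lra.
  have : c <= c - t.
    by apply: ge_inf => //; split; [apply/andP; split; lra|rewrite vct].
  lra.
case: H => [H|H].
  apply: Zc_false; exists r => // z; rewrite ltr_norml => /andP[rz zr].
  have Uz : `]c - r, c + r[%classic z.
    by rewrite /= in_itv/=; apply/andP; split; lra.
  split; [exact: sub|apply: H => //=; rewrite in_itv/=].
  by apply/andP; split; lra.
have Rc : metrically_regular a b f c.
  by apply: H; rewrite /= in_itv/=; apply/andP; split; lra.
have [d' d'0 Hd'] := metrically_regularP bvf Rc ltr01.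
pose t := Num.min (d' / 2) (y - c).
have t0 : 0 < t by rewrite lt_min divr_gt0//= subr_gt0.
have t1 : t <= d' / 2 by rewrite ge_min lexx.
have t2 : t <= y - c by rewrite ge_min lexx orbT.
have [] := Hd' (c + t).
- by rewrite in_itv/=; apply/andP; split; lra.
- by rewrite -subr_eq0 addrAC subrr add0r gt_eqF.
- by rewrite addrAC subrr add0r gtr0_norm//; lra.
- by rewrite vcy vc ?eqxx//; lra.
Qed.

(** A counter that runs only while f stands still, separating the points that v identifies. *)
Definition constancy_length y :=
  fine (lebesgue_measure (Z `&` `[a, y]%classic)).

Lemma measurable_locally_constant :
  measurable (Z : set (measurableTypeR R)).
Proof. by apply: open_measurable; exact: locally_constant_open. Qed.

Lemma constancy_lengthD x y : a <= x -> x <= y ->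
  (constancy_length y)%:E = ((constancy_length x)%:E +
    lebesgue_measure (Z `&` `]x, y]%classic))%E.
Proof.
move=> ax xy; have mZ := measurable_locally_constant.
have mc z : measurable (Z `&` `[a, z]%classic : set (measurableTypeR R)).
  by apply: measurableI => //; exact: measurable_itv.
have mo : measurable (Z `&` `]x, y]%classic : set (measurableTypeR R)).
  by apply: measurableI => //; exact: measurable_itv.
have fin z : a <= z -> lebesgue_measure (Z `&` `[a, z]%classic) \is a fin_num.
  move=> az; rewrite ge0_fin_numE ?measure_ge0//.
  apply: (@le_lt_trans _ _ (lebesgue_measure `[a, z]%classic)).
    by apply: le_lebesgue_measure => //; exact: subIsetr.
  by rewrite lebesgue_measure_segment// ltry.
rewrite /constancy_length !fineK ?fin//; last lra.
have -> : Z `&` `[a, y]%classic =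
    (Z `&` `[a, x]%classic) `|` (Z `&` `]x, y]%classic).
  rewrite -setIUr; congr (_ `&` _); apply/seteqP; split => z /=.
    rewrite !in_itv/= => /andP[az zy].
    by have [zx|xz] := leP z x; [left; rewrite az|right; rewrite zy].
  by rewrite !in_itv/= => -[/andP[? ?]|/andP[? ?]]; apply/andP; split; lra.
rewrite measureU//; apply/seteqP; split => // z [[_ +] [_ +]].
by rewrite /= !in_itv/= => /andP[? ?] /andP[? ?]; lra.
Qed.

Lemma constancy_length_bounds x y : a <= x -> x <= y ->
  0 <= constancy_length y - constancy_length x <= y - x.
Proof.
move=> ax xy; have := constancy_lengthD ax xy.
have : (lebesgue_measure (Z `&` `]x, y]%classic) <= (y - x)%:E)%E.
  apply: (@le_trans _ _ (lebesgue_measure `[x, y]%classic)).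
    apply: le_lebesgue_measure.
    - apply: measurableI; first exact: measurable_locally_constant.
      exact: measurable_itv.
    - exact: measurable_itv.
    - move=> z [_]; rewrite /= !in_itv/= => /andP[? ?].
      by apply/andP; split; lra.
  by rewrite lebesgue_measure_segment.
have : (0 <= lebesgue_measure (Z `&` `]x, y]%classic))%E by exact: measure_ge0.
case: lebesgue_measure => [r||]//.
by rewrite !lee_fin -EFinD => ? ? [] ?; apply/andP; split; lra.
Qed.

Lemma constancy_length_eq x y : a <= x -> x <= y ->
  (forall z, x < z <= y -> ~ Z z) ->
  constancy_length y = constancy_length x.
Proof.
move=> ax xy nZ; have := constancy_lengthD ax xy.
rewrite (_ : Z `&` _ = set0) ?measure0 ?adde0; first by case.
rewrite -subset0 => z [Zz]; rewrite /= in_itv/= => Hz; exact: nZ Hz Zz.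
Qed.

Lemma constancy_length_lt x y : a <= x -> x < y ->
  (forall z, x < z < y -> Z z) ->
  constancy_length x < constancy_length y.
Proof.
move=> ax xy ZZ; have := constancy_lengthD ax (ltW xy).
have : ((y - x)%:E <= lebesgue_measure (Z `&` `]x, y]%classic))%E.
  have -> : (y - x)%:E = lebesgue_measure `]x, y[%classic.
    by rewrite lebesgue_measure_itv/= lte_fin xy.
  apply: le_lebesgue_measure.
  - exact: measurable_itv.
  - apply: measurableI; first exact: measurable_locally_constant.
    exact: measurable_itv.
  - move=> z; rewrite /= in_itv/= => Hz; split; first exact: ZZ.
    by rewrite /= in_itv/=; case/andP: Hz => -> /ltW ->.
by case: lebesgue_measure => [r||]//; rewrite lee_fin -EFinD => ? [] ?; lra.
Qed.

End singular_set.

(** * Reparametrization *)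

(** The intermediate value theorem provides the inverse k, and a monotone surjection between
    segments is continuous. *)
Lemma increasing_homeomorphism {R : realType} (a b : R) (H : R -> R) : a < b ->
  {within `[a, b], continuous H} -> H a = a -> H b = b ->
  (forall x y, a <= x -> x < y -> y <= b -> H x < H y) ->
  exists k : R -> R,
  [/\ homeomorphism `[a, b]%classic `[a, b]%classic k,
      {within `[a, b], continuous k},
      forall x, x \in `[a, b] -> k x \in `[a, b] &
      forall x, x \in `[a, b] -> H (k x) = x].
Proof.
move=> ab cH Ha Hb Hlt.
have /choice[k Hk] x : exists y, x \in `[a, b] -> y \in `[a, b] /\ H y = x.
  have [xab|xab] := boolP (x \in `[a, b]); last by exists 0.
  have [|y yab Hy] := @IVT _ H a b x (ltW ab) cH; last by exists y.
  by rewrite Ha Hb (min_l (ltW ab)) (max_r (ltW ab)); move: xab; rewrite in_itv.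
have kab x : x \in `[a, b] -> k x \in `[a, b] by case/Hk.
have Hkx x : x \in `[a, b] -> H (k x) = x by case/Hk.
have Hle x y : x \in `[a, b] -> y \in `[a, b] -> x <= y -> H x <= H y.
  rewrite !in_itv/= => /andP[ax xb] /andP[ay yb].
  by rewrite le_eqVlt => /predU1P[->//|xy]; exact/ltW/Hlt.
have Hmono : {in `[a, b] &, {mono H : x y / x <= y}}.
  move=> x y xab yab; apply/idP/idP; last exact: Hle.
  rewrite leNgt => Hxy; rewrite leNgt; apply: contraNN Hxy.
  move: xab yab; rewrite !in_itv/= => /andP[ax xb] /andP[ay yb] yx.
  exact: Hlt.
have aab : a \in `[a, b] by rewrite in_itv/= lexx ltW.
have bab : b \in `[a, b] by rewrite in_itv/= lexx ltW.
have HI x : x \in `[a, b] -> H x \in `[a, b].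
  move=> xab; move: (xab); rewrite !in_itv/= => /andP[ax xb].
  by rewrite -[X in X <= _]Ha -[X in _ && (_ <= X)]Hb !Hle.
have kH y : y \in `[a, b] -> k (H y) = y.
  move=> yab; have Hy := HI y yab; have kHy := kab _ Hy.
  apply/le_anti/andP; split; first by rewrite -Hmono// Hkx.
  by rewrite -Hmono// Hkx.
have ka : k a = a by rewrite -{1}Ha kH.
have kb : k b = b by rewrite -{1}Hb kH.
have ck : {within `[a, b], continuous k}.
  apply: segment_inc_surj_continuous.
    by move=> x y xab yab; rewrite -Hmono ?kab// !Hkx.
  move=> y; rewrite ka kb /= => yab; exists (H y); last exact: kH.
  exact: HI.
exists k; split => //; exists H; split; last by split.
split.
- by move=> x; exact: kab.
- by move=> x; exact: HI.
- by move=> x; rewrite inE; exact: Hkx.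
- by move=> x; rewrite inE; exact: kH.
Qed.

Section reparametrization.
Context {R : realType} {X : normedModType R}.
Variables (a b : R) (f : R -> X).
Hypothesis ab : a < b.
Hypothesis cf : {within `[a, b], continuous f}.
Hypothesis bvf : (total_vvariation a b f < +oo)%E.
Local Notation v := (arc a f).
Local Notation M := (metrically_singular_set a b f).
Local Notation Z := (locally_constant_set a b f).
Local Notation zeta := (constancy_length a b f).
Variables rho w : R -> R.
Hypothesis crho : forall s e : R, 0 < e -> exists2 d : R, 0 < d &
  forall t, `|t - s| < d -> `|rho t - rho s| <= e.
Hypothesis rho01 : forall s, 0 <= rho s <= 1.
Hypothesis rhoN : forall s, (v @` M) s -> rho s = 0.
Hypothesis cw : {within `[0, v b], continuous w}.
Hypothesis w_ge : forall s t,
  0 <= s -> s <= t -> t <= v b -> t - s <= w t - w s.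
Hypothesis w_speed : forall s e : R, s \in `[0, v b] -> 0 < e ->
  exists2 d : R, 0 < d & forall t, t \in `[0, v b] -> `|t - s| < d ->
    `| `|t - s| - rho s * `|w t - w s| | <= e * `|w t - w s|.

(** The first summand prescribes the speed but is constant where f is; the second one restores
    strict monotonicity. *)
Definition new_time y := w (v y) + zeta y.
Local Notation h := new_time.

Lemma arc_itv y : y \in `[a, b] -> v y \in `[0, v b].
Proof.
rewrite !in_itv/= => /andP[ay yb]; rewrite -(arca a f).
by rewrite !(arc_le bvf).
Qed.

Lemma new_timeB x y : a <= x -> x <= y -> y <= b ->
  0 <= w (v y) - w (v x) <= h y - h x.
Proof.
move=> ax xy yb; have /andP[z0 _] := constancy_length_bounds b f ax xy.
have vxy := arc_le bvf ax xy yb.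
have : v y - v x <= w (v y) - w (v x).
  apply: w_ge => //; last by apply: (arc_le bvf) => //; lra.
  by rewrite -(arca a f); apply: (arc_le bvf) => //; lra.
by rewrite /h => ?; apply/andP; split; lra.
Qed.

Lemma dist_new_time x y : x \in `[a, b] -> y \in `[a, b] ->
  `|w (v y) - w (v x)| <= `|h y - h x|.
Proof.
rewrite !in_itv/= => /andP[ax xb] /andP[ay yb].
have [xy|/ltW yx] := leP x y.
  have /andP[? ?] := new_timeB ax xy yb.
  by rewrite !ger0_norm//; lra.
have /andP[? ?] := new_timeB ay yx xb.
by rewrite !(distrC _ (h x)) !(distrC _ (w (v x))) !ger0_norm//; lra.
Qed.

(** Either v x = v y, so that f is constant on [x, y] and zeta increases, or v increases strictly
    and so does w o v. *)
Lemma new_time_lt x y : a <= x -> x < y -> y <= b -> h x < h y.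
Proof.
move=> ax xy yb; have := arc_le bvf ax (ltW xy) yb.
rewrite le_eqVlt => /predU1P[vxy|vxy].
  rewrite /h vxy ltrD2l; apply: constancy_length_lt => // z /andP[xz zy].
  exists (Num.min (z - x) (y - z)); first by rewrite lt_min !subr_gt0 xz.
  have zab : z \in `[a, b] by rewrite in_itv/=; apply/andP; split; lra.
  have vz t : x <= t -> t <= y -> v t = v x.
    move=> xt ty; apply/le_anti/andP; split.
      by rewrite vxy; apply: (arc_le bvf) => //; lra.
    by apply: (arc_le bvf) => //; lra.
  move=> t; rewrite lt_min !ltr_norml => /andP[/andP[t1 _] /andP[_ t2]].
  have tab : t \in `[a, b] by rewrite in_itv/=; apply/andP; split; lra.
  by split => //; apply: (arc_eq bvf) => //; rewrite !vz//; lra.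
have /andP[z0 _] := constancy_length_bounds b f ax (ltW xy).
have : v y - v x <= w (v y) - w (v x).
  apply: w_ge; [|exact: ltW|by apply: (arc_le bvf) => //; lra].
  by rewrite -(arca a f); apply: (arc_le bvf) => //; lra.
by rewrite /h; lra.
Qed.

Lemma new_time_continuous : {within `[a, b], continuous h}.
Proof.
apply/(@within_continuousP R R) => x xab e e0.
have e20 : 0 < e / 2 by lra.
have /(@within_continuousP R R)/(_ _ (arc_itv xab) _ e20)[d1 d10 H1] := cw.
have d12 : 0 < d1 / 2 by lra.
have /(@within_continuousP R R)/(_ _ xab _ d12)[d2 d20 H2] :=
  arc_continuous bvf cf.
exists (Num.min d2 (e / 2)); first by rewrite lt_min d20 e20.
move=> y yab; rewrite lt_min => /andP[yd ye].
have /(H1 _ (arc_itv yab)) Hw : `|v y - v x| < d1 by have := H2 _ yab yd; lra.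
have Hz : `|zeta y - zeta x| <= e / 2.
  apply: le_trans (ltW ye).
  move: xab yab; rewrite !in_itv/= => /andP[ax xb] /andP[ay yb].
  have [xy|/ltW yx] := leP x y.
    have /andP[z0 z1] := constancy_length_bounds b f ax xy.
    by rewrite !ger0_norm//; lra.
  have /andP[z0 z1] := constancy_length_bounds b f ay yx.
  by rewrite distrC (distrC y) !ger0_norm//; lra.
have -> : h y - h x = (w (v y) - w (v x)) + (zeta y - zeta x).
  by rewrite /h; lra.
by apply: le_trans (ler_normD _ _) _; lra.
Qed.

(** Three cases. On M, rho vanishes and the increment of f is at most that of v, which is negligible
    against that of w. On an interval of constancy both f and rho o v contribute nothing. Near
    regular points zeta is constant, and the increments of f, of v and of w scaled by rho are
    comparable. *)
Lemma new_time_speed y e : y \in `[a, b] -> 0 < e -> exists2 d : R, 0 < d &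
  forall z, z \in `[a, b] -> `|z - y| < d ->
    `| `|f z - f y| - rho (v y) * `|h z - h y| | <= e * `|h z - h y|.
Proof.
move=> yab e0.
have [My|] := pselect (M y).
  have [d1 d10 H1] := w_speed (arc_itv yab) e0.
  have d12 : 0 < d1 / 2 by lra.
  have /(@within_continuousP R R)/(_ _ yab _ d12)[d2 d20 H2] :=
    arc_continuous bvf cf.
  exists d2 => // z zab zy.
  have /(H1 _ (arc_itv zab)) : `|v z - v y| < d1 by have := H2 _ zab zy; lra.
  have r0 : rho (v y) = 0 by apply: rhoN; exists y.
  rewrite r0 !mul0r !subr0 !normr_id => Hv.
  apply: le_trans (dist_le_arc bvf yab zab) _; apply: le_trans Hv _.
  by rewrite ler_pM2l// dist_new_time.
move=> nM.
have /contrapT[d [d0 sub H]] : ~ ~ exists delta : R,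
    let U := `]y - delta, y + delta[%classic in
    [/\ 0 < delta, U `<=` `[a, b]%classic
      & (forall y z, U y -> U z -> f y = f z) \/
        (forall y, U y -> metrically_regular a b f y)].
  by move=> H; apply: nM.
have UP z : `|z - y| < d -> `]y - d, y + d[%classic z.
  by rewrite ltr_norml /= in_itv/= => /andP[? ?]; apply/andP; split; lra.
have Uy : `]y - d, y + d[%classic y by apply: UP; rewrite subrr normr0.
case: H => H.
  have Zy : Z y by exists d => // z /UP Uz; split; [exact: sub|exact: H].
  (* Although y is not in M, v y is the arc length of a singular point, the left end of the interval
     of constancy. *)
  have r0 : rho (v y) = 0.
    by apply: rhoN; exact: (locally_constant_arc_singular cf bvf Zy).
  exists d => // z zab /UP Uz; rewrite r0 mul0r subr0 normr_id (H z y)//.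
  by rewrite subrr normr0 mulr_ge0// ltW.
(* Since rho and e2 are at most 1, V <= (rho + e2) W <= 2 W; the two errors e1 * V and e2 * W are
   then at most e / 2 * W each. *)
pose e1 := e / 4; pose e2 := Num.min 1 (e / 2).
have e10 : 0 < e1 by rewrite divr_gt0.
have e20 : 0 < e2 by rewrite lt_min ltr01 divr_gt0.
have e21 : e2 <= 1 by rewrite ge_min lexx.
have e22 : e2 <= e / 2 by rewrite ge_min lexx orbT.
have [d1 d10 H1] := metrically_regularP bvf (H y Uy) e10.
have [d2 d20 H2] := w_speed (arc_itv yab) e20.
have d22 : 0 < d2 / 2 by lra.
have /(@within_continuousP R R)/(_ _ yab _ d22)[d3 d30 H3] :=
  arc_continuous bvf cf.
exists (Num.min d (Num.min d1 d3)); first by rewrite !lt_min d0 d10.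
move=> z zab; rewrite !lt_min => /and3P[zd zd1 zd3].
have [->|zy] := eqVneq z y; first by rewrite !subrr !normr0 !mulr0 subrr normr0.
have nZ t : Num.min z y <= t <= Num.max z y -> ~ Z t.
  move=> Ht; apply: (regular_not_locally_constant bvf); apply: H; apply: UP.
  by apply: dist_minmax Ht => //; rewrite subrr normr0.
have hE : `|h z - h y| = `|w (v z) - w (v y)|.
  suff zE : zeta z = zeta y.
    by rewrite /h zE; congr `|_|; lra.
  move: zab yab; rewrite !in_itv/= => /andP[az zb] /andP[ay yb].
  have [yz|/ltW zy'] := leP y z.
    apply: constancy_length_eq => // t /andP[yt tz]; apply: nZ.
    by rewrite min_r// max_l// tz ltW.
  apply/esym/constancy_length_eq => // t /andP[zt ty]; apply: nZ.
  by rewrite min_l// max_r// ty ltW.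
have [_ Hf] := H1 z zab zy zd1.
have /(H2 _ (arc_itv zab)) Hv : `|v z - v y| < d2 by have := H3 _ zab zd3; lra.
rewrite hE; move: Hf Hv; have /andP[r0 r1] := rho01 (v y).
have := normr_ge0 (w (v z) - w (v y)); have := normr_ge0 (v z - v y).
set W := `|w _ - _|; set V := `|v _ - _|; set F := `|f _ - _| => V0 W0.
rewrite !ler_norml => /andP[f1 f2] /andP[v1 v2].
have rW : rho (v y) * W <= W by rewrite ler_piMl.
have e2W : e2 * W <= W by rewrite ler_piMl.
have e2W' : e2 * W <= e / 2 * W by rewrite ler_wpM2r.
have V2 : V <= 2 * W by lra.
have e1V : e1 * V <= e / 2 * W by rewrite /e1; nra.
by apply/andP; split; lra.
Qed.

Lemma exists_homeomorphism : exists k : R -> R,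
  [/\ homeomorphism `[a, b]%classic `[a, b]%classic k,
      (forall x, x \in `[a, b] -> md_exists a b (f \o k) x)
    & {within `[a, b], continuous (md a b (f \o k))}].
Proof.
have hab : h a < h b by exact: new_time_lt.
(* The affine rescaling of h that maps [a, b] onto itself. It divides the speed by c, so the metric
   derivative of f o k is rho o v o k / c. *)
pose c := (b - a) / (h b - h a).
have c0 : 0 < c by rewrite divr_gt0// subr_gt0.
pose H y := a + c * (h y - h a).
have HB y z : `|H z - H y| = c * `|h z - h y|.
  by rewrite -[X in X * _](gtr0_norm c0) -normrM /H; congr `|_|; lra.
have [|||||k [hk ck kab Hk]] := @increasing_homeomorphism _ a b H => //.
- apply/(@within_continuousP R R) => x xab e e0.
  have ec : 0 < e / c by rewrite divr_gt0.
  have /(@within_continuousP R R)/(_ _ xab _ ec)[d d0 Hd] :=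
    new_time_continuous.
  exists d => // y yab /(Hd _ yab); rewrite HB ler_pdivlMr//.
  by rewrite mulrC.
- by rewrite /H subrr mulr0 addr0.
- by rewrite /H /c mulfVK ?gt_eqF ?subr_gt0//; lra.
- by move=> x y ax xy yb; rewrite /H ltrD2l ltr_pM2l// ltrD2r new_time_lt.
have Hmd x : x \in `[a, b] -> is_md a b (f \o k) x (rho (v (k x)) / c).
  move=> xab; apply/is_mdP => // e e0.
  have [d d0 Hd] := new_time_speed (kab _ xab) (mulr_gt0 e0 c0).
  have d20 : 0 < d / 2 by lra.
  have /(@within_continuousP R R)/(_ _ xab _ d20)[d' d'0 Hd'] := ck.
  exists d' => // y yab yx.
  have /(Hd _ (kab _ yab)) : `|k y - k x| < d by have := Hd' _ yab yx; lra.
  have -> : `|y - x| = c * `|h (k y) - h (k x)| by rewrite -HB !Hk.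
  by rewrite (mulrA e) (mulrA (_ / c)) (divfK (lt0r_neq0 c0)).
exists k; split => //.
  by move=> x xab; exists (rho (v (k x)) / c); exact: Hmd.
apply/(@within_continuousP R R) => x xab e e0.
have [d1 d10 H1] := crho (v (k x)) (mulr_gt0 e0 c0).
have d12 : 0 < d1 / 2 by lra.
have /(@within_continuousP R R)/(_ _ (kab _ xab) _ d12)[d2 d20 H2] :=
  arc_continuous bvf cf.
have d22 : 0 < d2 / 2 by lra.
have /(@within_continuousP R R)/(_ _ xab _ d22)[d d0 Hd] := ck.
exists d => // y yab yx.
rewrite (mdE ab yab (Hmd _ yab)) (mdE ab xab (Hmd _ xab)) -mulrBl normrM.
rewrite [X in _ * X]gtr0_norm ?invr_gt0// ler_pdivrMr//; apply: H1.
have /(H2 _ (kab _ yab)) : `|k y - k x| < d2 by have := Hd _ yab yx; lra.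
lra.
Qed.

End reparametrization.

Theorem theorem6p1 (R : realType) (X : completeNormedModType R) (a b : R)
    (hab : a < b) (f : R -> X) :
  (exists k : R -> R,
    [/\ homeomorphism `[a, b]%classic `[a, b]%classic k,
        (forall x, x \in `[a, b] -> md_exists a b (f \o k) x)
      & {within `[a, b], continuous (md a b (f \o k))}])
  <->
  [/\ {within `[a, b], continuous f},
      (total_vvariation a b f < +oo)%E
    & hausdorff1 (f @` metrically_singular_set a b f) = 0%E].
Proof.
split=> [[k [[h [[kab hab' kh hk] [ck ch]]] mdk cmd]]|[cf bvf H0]]; last first.
  have vb0 : 0 <= arc a f b by rewrite -(arca a f) (arc_le bvf) ?lexx ?ltW.
  have cN := arc_singular_closed cf bvf.
  have N0 := arc_singular_null hab cf bvf H0.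
  have [rho [w [crho rho01 rhoN cw [w_ge w_speed]]]] := exists_clock vb0 cN N0.
  exact: (exists_homeomorphism hab cf bvf crho rho01 rhoN cw w_ge w_speed).
(* From (i) to (ii): f o k plays the role of g, and f = g o h where h is the inverse of k. *)
pose m := md a b (f \o k).
have gm x : x \in `[a, b] -> is_md a b (f \o k) x (m x).
  by move=> xab; have [c Hc] := mdk x xab; rewrite /m (mdE hab xab Hc).
have hI y : y \in `[a, b] -> h y \in `[a, b] by move=> yab; exact: hab'.
have hinj : {in `[a, b] &, injective h}.
  move=> x y xab yab hxy; rewrite -(hk x) ?inE// -(hk y) ?inE//.
  by rewrite hxy.
have fE y : y \in `[a, b] -> f y = (f \o k) (h y).
  by move=> yab /=; rewrite hk// inE.
split.
- apply/within_continuousP => y yab e e0.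
  have /within_continuousP/(_ _ (hI _ yab) _ e0)[d1 d10 H1] := md_continuous gm.
  have d12 : 0 < d1 / 2 by lra.
  have /(@within_continuousP R R)/(_ _ yab _ d12)[d d0 Hd] := ch.
  exists d => // z zab zy; rewrite !fE//; apply: H1; first exact: hI.
  by have := Hd _ zab zy; lra.
- exact: (homeo_bounded_variation hab gm cmd hI ch hinj fE).
- exact: (homeo_singular_null hab gm cmd hI ch hinj fE).
Qed.
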